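(* Let $a,b,c\ge0$ and consider $T=N^a$, $p=e^{N^b}$, $s_1=s_2=N^c$, $a_{N,T}=N$, with $\lambda_{N,T}=\sqrt{4NT\log(p)^3\log(a_{N,T})^3}$ and $\mu_{N,T}=\sqrt{4T\log(N)^3\log(a_{N,T})^3}$. Let assumptions (A1) and (A2b) be satisfied and assume that $\kappa^2$ is bounded away from zero. If $9b+2c<1$, then as $N\to\infty$ one has, with probability tending to one: (1) $\|\hat\beta-\beta^*\|\to0$; and $\|\hat c-c^*\|\to0$ if $3b+c<a$. (2) $\hat\beta_j$ will not be classified as zero (i.e. $\hat\beta_j\ne0$) for any $j\in J_1$ if $\beta_{\min}>\xi_{N,T}/\sqrt{NT}$ from a certain step and onwards. Similarly, no $\hat c_i$ will be classified as zero for $i\in J_2$ if $c_{\min}>\xi_{N,T}/\sqrt T$ from a certain step and onwards. Here $\xi_{N,T}=16\log(a_{N,T})^{3/2}\left[\log(p)^{3/2}\sqrt{s_1}+\log(N)^{3/2}\sqrt{s_2}\right]/\kappa^2$.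
   Context: Model: for $i=1,\dots,N$, $t=1,\dots,T$, $y_{i,t}=x_{i,t}'\beta^*+c_i^*+\epsilon_{i,t}$ with random covariates $x_{i,t}=(x_{i,t,1},\dots,x_{i,t,p})'\in\mathbb{R}^p$, unknown deterministic vectors $\beta^*\in\mathbb{R}^p$, $c^*\in\mathbb{R}^N$ and random errors $\epsilon_{i,t}$; all quantities may change with $N$. Put $X_i=(x_{i,1},\dots,x_{i,T})'$, $X=(X_1',\dots,X_N')'$, $\epsilon_i=(\epsilon_{i,1},\dots,\epsilon_{i,T})'$, $\epsilon=(\epsilon_1',\dots,\epsilon_N')'$, $y$ stacked in the same way, $D=I_N\otimes\iota$ with $\iota$ the $T\times1$ vector of ones, $Z=(X,D)$. Let $J_1=\{j:\beta_j^*\ne0\}$, $J_2=\{i:c_i^*\neq0\}$, $s_1=|J_1|$, $s_2=|J_2|$, $\beta_{\min}=\min\{|\beta_j^*|:j\in J_1\}$, $c_{\min}=\min\{|c_j^*|:j\in J_2\}$. $\|\cdot\|$, $\|\cdot\|_{\ell_1}$ are the $\ell_2$- and $\ell_1$-norms; $v_A$ is the subvector of $v$ indexed by $A$; $\log$ is the natural logarithm. The expressions $N^a,e^{N^b},N^c$ are understood up to rounding to integers. Panel Lasso: $(\hat\beta',\hat c')'$ minimizes $\|y-Z\gamma\|^2+2\lambda_{N,T}\|\beta\|_{\ell_1}+2\mu_{N,T}\|c\|_{\ell_1}$ over $\gamma=(\beta',c')'\in\mathbb{R}^{p+N}$. Let $\Gamma=\mathrm{diag}(E(X'X/(NT)),I_N)$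 (block diagonal) and let $\kappa^2$ be the minimum of $\delta'\Gamma\delta/\|\delta\|^2$ over all $\delta=({\delta^1}',{\delta^2}')'\in\mathbb{R}^{p+N}\setminus\{0\}$ ($\delta^1\in\mathbb{R}^p$, $\delta^2\in\mathbb{R}^N$) and all $R_1\subseteq\{1,\dots,p\}$, $R_2\subseteq\{1,\dots,N\}$ with $|R_1|\le s_1$, $|R_2|\le s_2$ and $\frac{\lambda_{N,T}}{\sqrt{NT}}\|\delta^1_{R_1^c}\|_{\ell_1}+\frac{\mu_{N,T}}{\sqrt T}\|\delta^2_{R_2^c}\|_{\ell_1}\le 3\frac{\lambda_{N,T}}{\sqrt{NT}}\|\delta^1_{R_1}\|_{\ell_1}+3\frac{\mu_{N,T}}{\sqrt T}\|\delta^2_{R_2}\|_{\ell_1}$. (A1): (a) $\{(X_i,\epsilon_i)\}_{i=1}^N$ are independent and identically distributed; (b) $X_i$ and $\epsilon_i$ are independent for each $i$; (c) for each $i$, $\{\epsilon_{i,t},\mathcal{F}_{i,t}\}_{t=1}^T$ with $\mathcal{F}_{i,t}=\sigma(\epsilon_{i,1},\dots,\epsilon_{i,t})$ is a martingale difference sequence ($E(\epsilon_{i,t}\mid\mathcal{F}_{i,t-1})=0$, $\mathcal F_{i,0}$ trivial). (A2b): there are constants $C,K>0$ (not depending on $N$) with $P(|x_{1,t,k}|\ge u)\le\frac12Ke^{-Cu^2}$ and $P(|\epsilon_{1,t}|\ge u)\le\frac12Ke^{-Cu^2}$ for all $u>0$, $1\le t\le T$, $1\le k\le p$. *)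

(* Defs.v *)
From HB Require Import structures.
From mathcomp Require Import all_boot all_order all_algebra.
From mathcomp Require Import all_classical all_reals all_analysis.

Set Implicit Arguments.
Unset Strict Implicit.
Unset Printing Implicit Defensive.

Import Order.TTheory GRing.Theory Num.Theory.
Import numFieldNormedType.Exports.

Local Open Scope classical_set_scope.
Local Open Scope ring_scope.

(* Either of the two integers next to x (and x itself if x is an integer), so
   that floor, ceiling and nearest-integer rounding are all allowed. *)
Definition is_rounding (R : realType) (n : nat) (x : R) : Prop :=
  `|n%:R - x| < 1.

Section Vectors.
Context {R : realType} {n : nat}.
Implicit Types (v : 'cV[R]_n) (A : {set 'I_n}).

Definition l2norm v : R := Num.sqrt (\sum_j v j 0 ^+ 2).

(* The l1-norm of the subvector v_A. *)
Definition l1norm_on A v : R := \sum_(j in A) `|v j 0|.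

Definition l1norm v : R := l1norm_on [set: 'I_n] v.

Definition support_set v : {set 'I_n} := [set j | v j 0 != 0]%SET.

(* A minimum, since the set is finite; it equals 0 when v = 0. *)
Definition min_abs_support v : R :=
  inf [set r : R | exists2 j, j \in support_set v & r = `|v j 0|].

End Vectors.

Section Probability.
Context {d : measure_display} {Om : measurableType d} {R : realType}.
Variable P : probability Om R.

Definition mutually_independent {I : finType} {d' : measure_display}
    {S : measurableType d'} (W : I -> Om -> S) : Prop :=
  forall A : I -> set S, (forall i, measurable (A i)) ->
    P (\bigcap_i (W i @^-1` A i)) = (\prod_i P (W i @^-1` A i))%E.

Definition identically_distributed {I : Type} {d' : measure_display}
    {S : measurableType d'} (W : I -> Om -> S) : Prop :=
  forall i j (A : set S), measurable A ->
    pushforward P (W i) A = pushforward P (W j) A.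

Definition independent2 {d1 d2 : measure_display}
    {S1 : measurableType d1} {S2 : measurableType d2}
    (U : Om -> S1) (V : Om -> S2) : Prop :=
  forall A B, measurable A -> measurable B ->
    P (U @^-1` A `&` V @^-1` B) = (P (U @^-1` A) * P (V @^-1` B))%E.

(* Z is a version of the conditional expectation E(Y | G). *)
Definition is_cond_exp (G : set (set Om)) (Y Z : Om -> R) : Prop :=
  [/\ P.-integrable setT (EFin \o Y),
      P.-integrable setT (EFin \o Z),
      forall B : set R, measurable B -> G (Z @^-1` B) &
      forall A, G A -> (\int[P]_(w in A) (Y w)%:E = \int[P]_(w in A) (Z w)%:E)%E].

(* The sigma-algebra generated by the e_s with s < t; it is trivial for the
   first (i.e. the 0-th) index t. *)
Definition strict_past {T : nat} (e : 'I_T -> Om -> R) (t : 'I_T) :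
    set (set Om) :=
  g_sigma_preimage (fun s : 'I_t => e (widen_ord (ltnW (ltn_ord t)) s)).

Definition martingale_difference {T : nat} (e : 'I_T -> Om -> R) : Prop :=
  forall t, is_cond_exp (strict_past e t) (e t) (fun=> 0).

End Probability.

Section Panel.
Context {d : measure_display} {Om : measurableType d} {R : realType}.
Context {P : probability Om R} {N T p : nat}.
Implicit Types (x : 'I_N -> 'I_T -> 'I_p -> {RV P >-> R})
  (eps : 'I_N -> 'I_T -> {RV P >-> R}).

(* X_i and eps_i as elements of product measurable spaces. *)
Definition X_tuple x (i : 'I_N) (w : Om) : T.-tuple (p.-tuple R) :=
  [tuple [tuple x i t k w | k < p] | t < T].

Definition eps_tuple eps (i : 'I_N) (w : Om) : T.-tuple R :=
  [tuple eps i t w | t < T].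

Definition assumption_A1 x eps : Prop :=
  [/\ mutually_independent P (fun i w => (X_tuple x i w, eps_tuple eps i w)),
      identically_distributed P
        (fun i w => (X_tuple x i w, eps_tuple eps i w)),
      forall i, independent2 P (X_tuple x i) (eps_tuple eps i) &
      forall i, martingale_difference P (fun t => eps i t)].

(* The index i with value 0 is the first cross-sectional unit. *)
Definition assumption_A2b (C K : R) x eps : Prop :=
  forall i : 'I_N, i = 0%N :> nat -> forall (t : 'I_T) (u : R), 0 < u ->
    (forall k : 'I_p,
      (P [set w | (u <= `|x i t k w|)%R] <= (2^-1 * K * expR (- C * u ^+ 2))%:E)%E)
    /\ (P [set w | (u <= `|eps i t w|)%R] <=
         (2^-1 * K * expR (- C * u ^+ 2))%:E)%E.

Definition X_mx x (i : 'I_N) (w : Om) : 'M[R]_(T, p) :=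
  \matrix_(t, k) x i t k w.

Definition response x eps (beta : 'cV[R]_p) (c : 'cV[R]_N) (i : 'I_N)
    (w : Om) : 'cV[R]_T :=
  X_mx x i w *m beta + c i 0 *: const_mx 1 + \col_t eps i t w.

(* |y - Z gamma|^2 is summed over the N blocks of length T: the i-th block of
   Z gamma = X beta + D c is X_i beta + c_i iota. *)
Definition lasso_objective (lambda mu : R) (X : 'I_N -> 'M[R]_(T, p))
    (y : 'I_N -> 'cV[R]_T) (beta : 'cV[R]_p) (c : 'cV[R]_N) : R :=
  \sum_i l2norm (y i - (X i *m beta + c i 0 *: const_mx 1)) ^+ 2
  + 2 * lambda * l1norm beta + 2 * mu * l1norm c.

Definition is_panel_lasso (lambda mu : R) (X : 'I_N -> 'M[R]_(T, p))
    (y : 'I_N -> 'cV[R]_T) (bhat : 'cV[R]_p) (chat : 'cV[R]_N) : Prop :=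
  forall beta c, lasso_objective lambda mu X y bhat chat
                 <= lasso_objective lambda mu X y beta c.

(* E(X'X / (NT)), where X'X is the sum of the X_i'X_i. *)
Definition expected_gram x : 'M[R]_p :=
  \matrix_(k, l) fine 'E_P[fun w =>
    (((N * T)%:R)^-1 *: \sum_i ((X_mx x i w)^T *m X_mx x i w)) k l]%E.

Definition Gamma x : 'M[R]_(p + N) := block_mx (expected_gram x) 0 0 1%:M.

Definition cone_condition (lambda mu : R) (R1 : {set 'I_p}) (R2 : {set 'I_N})
    (delta : 'cV[R]_(p + N)) : Prop :=
  let lam := lambda / Num.sqrt (N * T)%:R in
  let m := mu / Num.sqrt T%:R in
  lam * l1norm_on (~: R1)%SET (usubmx delta)
    + m * l1norm_on (~: R2)%SET (dsubmx delta)
  <= 3 * lam * l1norm_on R1 (usubmx delta)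
    + 3 * m * l1norm_on R2 (dsubmx delta).

(* The infimum is a minimum: the quotient is continuous and homogeneous of
   degree 0, and the constraint set is a finite union of closed cones. *)
Definition kappa2 x (lambda mu : R) (s1 s2 : nat) : R :=
  inf [set q : R | exists (R1 : {set 'I_p}) (R2 : {set 'I_N})
                          (delta : 'cV[R]_(p + N)),
    [/\ (#|R1| <= s1)%N, (#|R2| <= s2)%N, delta != 0,
        cone_condition lambda mu R1 R2 delta &
        q = (delta^T *m Gamma x *m delta) 0 0 / l2norm delta ^+ 2]].

End Panel.

Section Tuning.
Context {R : realType}.

Definition lambda_NT (N T p : nat) (aNT : R) : R :=
  Num.sqrt (4 * N%:R * T%:R * ln p%:R ^+ 3 * ln aNT ^+ 3).

Definition mu_NT (N T : nat) (aNT : R) : R :=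
  Num.sqrt (4 * T%:R * ln N%:R ^+ 3 * ln aNT ^+ 3).

Definition xi_NT (N p s1 s2 : nat) (aNT k2 : R) : R :=
  16 * ln aNT `^ (3 / 2)
  * (ln p%:R `^ (3 / 2) * Num.sqrt s1%:R + ln N%:R `^ (3 / 2) * Num.sqrt s2%:R)
  / k2.

End Tuning.

(* Main.v *)
Require Import Defs.
From HB Require Import structures.
From mathcomp Require Import all_boot all_order all_algebra.
From mathcomp Require Import all_classical all_reals all_analysis.
From mathcomp Require Import measurable_realfun.
From mathcomp Require Import zify ring lra.

(** Write [L = ln N] and [V = ln p].  The proof has a deterministic half and a
    probabilistic half.

    Deterministic half.  Comparing the objective at the estimate and at the
    truth gives the basic inequality of the Lasso as soon as the score
    [(X' eps, D' eps)] is bounded by [(lambda / 2, mu / 2)]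
    ([lasso_basic_inequality]).  It confines the rescaled estimation error to the
    cone in the definition of [kappa^2], on which l1-norms are dominated by
    l2-norms.  If the empirical Gram matrix of [(X, D)] is entrywise close to
    [Gamma], the restricted eigenvalue [kappa^2] is at most halved
    ([gram_lower_bound]), and the two facts together bound the rescaled error by
    [xi] ([oracle_inequality]).  Dividing by [sqrt (N T)] and [sqrt T] gives
    consistency, because [xi] is [N^((3b+c)/2)] up to logarithms, and a nonzero
    true coefficient larger than the error bound cannot be estimated by zero
    ([nonzero_of_min_abs_support]).  The condition [9b + 2c < 1] makes the
    perturbation of the Gram matrix vanish.

    Probabilistic half.  Each entry of the score is a sum of [n] martingale
    differences with sub-exponential tails, and only marginal tails are
    controlled.  Truncating the increments would need conditional expectations
    of the truncated variables, so moments are used instead.  Expanding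
    [E (S + D)^(2m)] by the binomial theorem, the term of first order in the
    increment [D] vanishes and the others are estimated by Hoelder's inequality;
    by induction [E S^(2m) <= (96 m n A^2)^m] when [E D^(2m) <= A^(2m)]
    ([orthogonal_moment_le]).  For sub-exponential increments [A] is of order
    [m], so [E S^(2m) <= (B m^3 n)^m], and Chebyshev's inequality with [m] a
    small multiple of [l] gives [P (|S| > sqrt (n l^3)) <= e^(1 - theta l)]
    ([orthogonal_sum_tail]).  With [l = V L] this is a negligible fraction of
    [1 / p] ([score_tail]), which is why [lambda] contains the cubes of both
    logarithms; [D' eps] and the Gram matrix are treated in the same way
    ([error_sum_tail], [gram_tail]).

    The vanishing of the first order term is [E (h eps_it) = 0] for functions
    [h] of the past.  A pi-system generating the past consists of intersections
    of an event of the other units, an event of [X_i] and an event of the earlier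
    errors of unit [i].  On such a set the integral of [eps_it] factors by
    independence and vanishes by the martingale difference property; Dynkin's
    lemma and approximation by simple functions extend this to all [h]
    ([orthogonal_measurable], [past_orthogonal]). *)

Set Implicit Arguments.
Unset Strict Implicit.
Unset Printing Implicit Defensive.

Import Order.TTheory GRing.Theory Num.Theory.
Import numFieldNormedType.Exports.

Local Open Scope classical_set_scope.
Local Open Scope ring_scope.

(** * Elementary inequalities *)

Section ElementaryInequalities.
Context {R : realType}.
Implicit Types x y z t : R.

Lemma expR_half_mul_le1 z : expR (z / 2) * (1 - z / 2) <= 1.
Proof.
rewrite -[leRHS](expRxMexpNx_1 (z / 2)) ler_wpM2l ?expR_ge0//.
exact: expR_ge1Dx.
Qed.

Lemma expR_le_quadratic z : 0 <= z <= 1 / 3 -> expR z <= 1 + z + z ^+ 2.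
Proof.
move=> /andP[z0 z1].
have h := expR_half_mul_le1 z.
have e : expR z = expR (z / 2) ^+ 2 by rewrite expr2 -expRD; congr expR; lra.
have h2 : expR z * (1 - z / 2) ^+ 2 <= 1.
  rewrite e -exprMn expr_le1//; apply: mulr_ge0; [exact: expR_ge0|lra].
have p : 0 < (1 - z / 2) ^+ 2 by apply: exprn_gt0; lra.
rewrite -(ler_pM2r p); apply: (le_trans h2); nra.
Qed.

(** For large [z] the constant 12 comes from [1 + z <= 12 z^2] on
    [z >= 1/3]. *)
Lemma expR_remainder_le z : 0 <= z ->
  1 + 2 * (expR z - 1 - z) <= expR (12 * z ^+ 2).
Proof.
move=> z0; have [zs|zl] := leP z (1 / 3).
  apply: (le_trans _ (expR_ge1Dx _)).
  have := @expR_le_quadratic z; rewrite z0 zs => /(_ isT); nra.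
apply: (@le_trans _ _ (expR (1 + z))); last by rewrite ler_expR; nra.
rewrite expRD; have := expR_ge1Dx (1 : R); have := expR_gt0 z; nra.
Qed.

Lemma expR_half_le t : 0 <= t <= 1 -> expR (t / 2) <= 1 + t.
Proof.
move=> /andP[t0 t1].
have h := expR_half_mul_le1 t.
have p : 0 < 1 - t / 2 by lra.
rewrite -(ler_pM2r p); apply: (le_trans h); nra.
Qed.

(** The cheap substitute for Young's inequality: the larger of the two numbers
    dominates any weighted geometric mean. *)
Lemma mulXX_le_add (a b : R) (n k : nat) : 0 <= a -> 0 <= b -> (k <= n)%N ->
  a ^+ (n - k) * b ^+ k <= a ^+ n + b ^+ n.
Proof.
move=> a0 b0 kn; have [ab|ba] := leP a b.
  apply: (@le_trans _ _ (b ^+ n)); last by rewrite lerDr exprn_ge0.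
  rewrite -[in leRHS](subnK kn) exprD ler_wpM2r ?exprn_ge0//.
  by rewrite lerXn2r.
apply: (@le_trans _ _ (a ^+ n)); last by rewrite lerDl exprn_ge0.
rewrite -[in leRHS](subnK kn) exprD ler_wpM2l ?exprn_ge0//.
by rewrite lerXn2r// ltW.
Qed.

Lemma fact_le_exp (m : nat) : m`!%:R <= m%:R ^+ m :> R.
Proof.
rewrite -natrX ler_nat; elim: m => // m ih.
rewrite factS expnS leq_mul// (leq_trans ih)//.
by case: m {ih} => // m; rewrite leq_exp2r.
Qed.

(** The arithmetic behind the induction step of the moment bound below: adding
    one increment to [k] earlier ones multiplies the [2m]-th moment by at most
    [1 + 2 (e^z - 1 - z)], where [z = 2m y], and this is at most
    [(1 + 1/k)^m]. *)
Lemma binomial_remainder_le (m k : nat) y : (0 < m)%N -> (0 < k)%N -> 0 <= y ->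
  y ^+ 2 * (96 * m%:R * k%:R) = 1 ->
  1 + 2 * ((1 + y) ^+ m.*2 - 1 - m.*2%:R * y) <= (1 + k%:R^-1) ^+ m.
Proof.
move=> m0 k0 y0 hy; set z := m.*2%:R * y.
have z0 : 0 <= z by rewrite mulr_ge0.
apply: (@le_trans _ _ (1 + 2 * (expR z - 1 - z))).
  rewrite lerD2l ler_pM2l// !lerD2r /z expRM_natl.
  by rewrite lerXn2r ?nnegrE ?expR_ge0 ?addr_ge0 ?expR_ge1Dx.
apply: (le_trans (expR_remainder_le z0)).
have kp : 0 < k%:R :> R by rewrite ltr0n.
have mp : 0 < m%:R :> R by rewrite ltr0n.
(* The constant 96 is chosen for this identity. *)
have -> : 12 * z ^+ 2 = m%:R * (k%:R^-1 / 2).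
  rewrite /z -muln2 natrM exprMn; have -> : y ^+ 2 = (96 * m%:R * k%:R)^-1.
    have c0 : 96 * m%:R * k%:R != 0 :> R by rewrite !mulf_neq0 ?gt_eqF.
    by apply: (mulIf c0); rewrite hy mulVf.
  by field; rewrite !gt_eqF.
rewrite expRM_natl lerXn2r ?nnegrE ?expR_ge0// ?addr_ge0 ?invr_ge0//.
by apply: expR_half_le; rewrite invr_ge0 ler0n invf_le1// ler1n.
Qed.

End ElementaryInequalities.

(** * Random variables with all moments *)

Lemma sum_ord_recl2 (V : nmodType) n (F : nat -> V) : (0 < n)%N ->
  \sum_(i < n.+1) F i = F 0%N + (F 1%N + \sum_(i < n.-1) F i.+2).
Proof. by case: n => // n _; rewrite !big_ord_recl. Qed.

Section Moments.
Context {d : measure_display} {Om : measurableType d} {R : realType}.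
Variable P : probability Om R.
Implicit Types (X Y : Om -> R) (c : R).

Local Notation E X := (Rintegral P setT X).

Lemma normX_even (x : R) m : `|x| ^+ m.*2 = x ^+ m.*2.
Proof. by rewrite -mul2n !exprM real_normK ?num_real. Qed.

Definition all_moments X : Prop :=
  measurable_fun setT X /\
  forall n, P.-integrable setT (fun w => (`|X w| ^+ n)%:E).

Lemma all_moments_measurable X : all_moments X -> measurable_fun setT X.
Proof. by case. Qed.

Lemma integrable_le X Y : measurable_fun setT X ->
  P.-integrable setT (EFin \o Y) -> (forall w, `|X w| <= Y w) ->
  P.-integrable setT (EFin \o X).
Proof.
move=> mX iY XY; apply: le_integrable iY => //; first exact/measurable_EFinP.
move=> w _ /=; rewrite lee_fin (le_trans (XY w))// ger0_norm//.
exact: le_trans (XY w).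
Qed.

(** Even powers suffice, since [|x|^n <= 1 + x^(2n)]. *)
Lemma all_moments_even X : measurable_fun setT X ->
  (forall n, (0 < n)%N -> P.-integrable setT (fun w => (X w ^+ n.*2)%:E)) ->
  all_moments X.
Proof.
move=> mX iX; split=> // n.
have i2 : P.-integrable setT (EFin \o (fun w => 1 + X w ^+ n.*2)).
  have -> : EFin \o (fun w => 1 + X w ^+ n.*2) =
    (cst 1%:E \+ (fun w => (X w ^+ n.*2)%:E))%E by apply/funext.
  apply: integrableD => //; first exact: finite_measure_integrable_cst.
  case: n => [|n]; last exact: iX.
  exact: finite_measure_integrable_cst.
apply: (integrable_le _ i2).
  by apply: measurable_funX; exact: measurableT_comp.
move=> w /=; rewrite ger0_norm ?exprn_ge0// -normX_even -muln2 exprM.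
set y := `|X w| ^+ n.
have := sqr_ge0 (y - 1); have : 0 <= y by rewrite exprn_ge0.
nra.
Qed.

Lemma all_moments_cst c : all_moments (cst c).
Proof.
split; first exact: measurable_cst.
by move=> n; exact: (finite_measure_integrable_cst P (`|c| ^+ n)).
Qed.

Lemma all_momentsM X Y : all_moments X -> all_moments Y ->
  all_moments (fun w => X w * Y w).
Proof.
move=> [mX iX] [mY iY]; split; first exact: measurable_funM.
move=> n; apply: (@integrable_le _ (fun w => `|X w| ^+ n.*2 + `|Y w| ^+ n.*2)).
- by apply: measurable_funX; apply: measurableT_comp => //;
    exact: measurable_funM.
- by apply: (integrableD _ (iX _) (iY _)).
move=> w; rewrite ger0_norm ?exprn_ge0// normrM exprMn -addnn.
have := @mulXX_le_add R `|X w| `|Y w| (n + n) n.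
by rewrite addnK leq_addr; apply.
Qed.

Lemma all_momentsD X Y : all_moments X -> all_moments Y ->
  all_moments (fun w => X w + Y w).
Proof.
move=> [mX iX] [mY iY]; split; first exact: measurable_funD.
move=> n.
apply: (@integrable_le _ (fun w => 2 ^+ n * `|X w| ^+ n + 2 ^+ n * `|Y w| ^+ n)).
- by apply: measurable_funX; apply: measurableT_comp => //;
    exact: measurable_funD.
- by apply: (integrableD _ (integrableZl _ _ (iX n)) (integrableZl _ _ (iY n))).
move=> w; rewrite ger0_norm ?exprn_ge0// -mulrDr.
apply: (@le_trans _ _ ((2 * Num.max `|X w| `|Y w|) ^+ n)).
  rewrite lerXn2r ?nnegrE ?mulr_ge0// ?le_max ?normr_ge0//.
  by rewrite (le_trans (ler_normD _ _))// mulr_natl mulr2n lerD// le_max lexx ?orbT.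
rewrite exprMn ler_wpM2l ?exprn_ge0//.
have [_|_] := leP `|X w| `|Y w|; rewrite ?lerDl ?lerDr exprn_ge0//.
Qed.

Lemma all_momentsX X n : all_moments X -> all_moments (fun w => X w ^+ n).
Proof.
move=> aX; elim: n => [|n ih]; first exact: all_moments_cst.
by under eq_fun do rewrite exprS; exact: all_momentsM.
Qed.

Lemma all_moments_sum (I : Type) (r : seq I) (Q : pred I) (F : I -> Om -> R) :
  (forall i, Q i -> all_moments (F i)) ->
  all_moments (fun w => \sum_(i <- r | Q i) F i w).
Proof.
move=> aF; elim: r => [|i r ih].
  by under eq_fun do rewrite big_nil; exact: all_moments_cst.
under eq_fun do rewrite big_cons.
by have [Qi|Qi] := boolP (Q i); [exact: all_momentsD (aF _ Qi) ih|exact: ih].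
Qed.

Lemma all_moments_integrable X : all_moments X ->
  P.-integrable setT (EFin \o X).
Proof.
move=> [mX iX]; apply: (integrable_le mX (iX 1%N)).
by move=> w; rewrite expr1.
Qed.

Lemma meanD X Y : all_moments X -> all_moments Y ->
  E (fun w => X w + Y w) = E X + E Y.
Proof.
by move=> /all_moments_integrable ? /all_moments_integrable ?; rewrite RintegralD.
Qed.

Lemma meanZ c X : all_moments X -> E (fun w => c * X w) = c * E X.
Proof. by move=> /all_moments_integrable ?; rewrite RintegralZl. Qed.

Lemma mean_cst c : E (cst c) = c.
Proof.
rewrite Rintegral_cst// -[RHS]mulr1; congr (_ * _).
exact: (congr1 (@fine R) (probability_setT P)).
Qed.

Lemma mean_sum (I : Type) (r : seq I) (Q : pred I) (F : I -> Om -> R) :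
  (forall i, Q i -> all_moments (F i)) ->
  E (fun w => \sum_(i <- r | Q i) F i w) = \sum_(i <- r | Q i) E (F i).
Proof.
move=> aF; elim: r => [|i r ih].
  rewrite big_nil; under eq_Rintegral do rewrite big_nil.
  exact: mean_cst.
rewrite big_cons; under eq_Rintegral do rewrite big_cons.
have [Qi|//] := boolP (Q i); rewrite meanD ?ih//; first exact: aF.
exact: all_moments_sum.
Qed.

Lemma le_mean X Y : all_moments X -> all_moments Y ->
  (forall w, X w <= Y w) -> E X <= E Y.
Proof.
by move=> /all_moments_integrable ? /all_moments_integrable ? XY;
  exact: le_Rintegral.
Qed.

Lemma mean_even_ge0 X m : 0 <= E (fun w => X w ^+ m.*2).
Proof.
by apply: Rintegral_ge0 => w _; rewrite -mul2n exprM exprn_ge0 ?sqr_ge0.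
Qed.

(** Hoelder's inequality for the exponents [n / (n - k)] and [n / k], with the
    harmless factor 2 in front, obtained by normalizing both variables. *)
Lemma mixed_moment_le X Y (u v : R) (m k : nat) :
  all_moments X -> all_moments Y -> 0 < u -> 0 < v -> (k <= m.*2)%N ->
  E (fun w => X w ^+ m.*2) <= u ^+ m.*2 ->
  E (fun w => Y w ^+ m.*2) <= v ^+ m.*2 ->
  E (fun w => X w ^+ (m.*2 - k) * Y w ^+ k) <= 2 * (u ^+ (m.*2 - k) * v ^+ k).
Proof.
move=> aX aY u0 v0 km EX EY; set n := m.*2.
pose c := u ^+ (n - k) * v ^+ k.
have c0 : 0 < c by rewrite mulr_gt0 ?exprn_gt0.
have aXn : all_moments (fun w => c / u ^+ n * X w ^+ n).
  by apply: all_momentsM; [exact: all_moments_cst|exact: all_momentsX].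
have aYn : all_moments (fun w => c / v ^+ n * Y w ^+ n).
  by apply: all_momentsM; [exact: all_moments_cst|exact: all_momentsX].
apply: (@le_trans _ _
  (E (fun w => c / u ^+ n * X w ^+ n + c / v ^+ n * Y w ^+ n))).
  apply: le_mean; first by apply: all_momentsM; exact: all_momentsX.
    exact: all_momentsD.
  move=> w.
  have h : (`|X w| / u) ^+ (n - k) * (`|Y w| / v) ^+ k <=
      (`|X w| / u) ^+ n + (`|Y w| / v) ^+ n.
    by apply: mulXX_le_add => //; rewrite divr_ge0// ltW.
  rewrite -(ler_pM2l c0) in h.
  have -> : c / u ^+ n * X w ^+ n + c / v ^+ n * Y w ^+ n =
      c * ((`|X w| / u) ^+ n + (`|Y w| / v) ^+ n).
    rewrite !expr_div_n !normX_even mulrDr; congr (_ + _);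
    by rewrite mulrAC mulrA.
  apply: le_trans h; rewrite !expr_div_n /c.
  rewrite [leRHS](_ : _ = `|X w ^+ (n - k) * Y w ^+ k|) ?ler_norm//.
  rewrite normrM !normrX; field.
  by rewrite !expf_neq0 ?gt_eqF.
rewrite meanD// !meanZ; [|exact: all_momentsX..].
rewrite mulr_natl mulr2n lerD//.
- by rewrite mulrAC ler_pdivrMr ?exprn_gt0// ler_pM2l.
- by rewrite mulrAC ler_pdivrMr ?exprn_gt0// ler_pM2l.
Qed.

(** If [Y] is orthogonal to [X^(2m-1)], the first order term of the binomial
    expansion of [E (X + Y)^(2m)] vanishes, so that adding the [k+1]-st
    increment only costs the factor [(1 + 1/k)^m]. *)
Lemma orthogonal_moment_step X Y (m k : nat) (A : R) :
  all_moments X -> all_moments Y -> 0 < A -> (0 < m)%N -> (0 < k)%N ->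
  E (fun w => X w ^+ m.*2) <= (96 * m%:R * k%:R * A ^+ 2) ^+ m ->
  E (fun w => Y w ^+ m.*2) <= A ^+ m.*2 ->
  E (fun w => X w ^+ m.*2.-1 * Y w) = 0 ->
  E (fun w => (X w + Y w) ^+ m.*2) <= (96 * m%:R * k.+1%:R * A ^+ 2) ^+ m.
Proof.
move=> aX aY A0 m0 k0 EX EY EXY.
have kp : 0 < k%:R :> R by rewrite ltr0n.
have mp : 0 < m%:R :> R by rewrite ltr0n.
have Kp : 0 < 96 * m%:R * k%:R :> R by rewrite !mulr_gt0.
pose u := Num.sqrt (96 * m%:R * k%:R) * A.
have u0 : 0 < u by rewrite mulr_gt0 ?sqrtr_gt0.
have u2 : u ^+ 2 = 96 * m%:R * k%:R * A ^+ 2.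
  by rewrite exprMn sqr_sqrtr// ltW.
have um : u ^+ m.*2 = (96 * m%:R * k%:R * A ^+ 2) ^+ m by rewrite -mul2n exprM u2.
rewrite -um in EX.
pose y := A / u.
have y0 : 0 <= y by rewrite divr_ge0 ?ltW.
have hy : y ^+ 2 * (96 * m%:R * k%:R) = 1.
  rewrite expr_div_n u2; field.
  by rewrite !gt_eqF.
have -> : (fun w => (X w + Y w) ^+ m.*2) = (fun w =>
    \sum_(i < m.*2.+1) 'C(m.*2, i)%:R * (X w ^+ (m.*2 - i) * Y w ^+ i)).
  by apply/funext => w; rewrite exprDn; apply: eq_bigr => i _; rewrite mulr_natl.
have aM i : all_moments (fun w => X w ^+ (m.*2 - i) * Y w ^+ i).
  by apply: all_momentsM; exact: all_momentsX.
rewrite mean_sum; last first.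
  by move=> i _; apply: all_momentsM => //; exact: all_moments_cst.
under eq_bigr do rewrite meanZ//.
apply: (@le_trans _ _ (u ^+ m.*2 *
    (1 + 2 * ((1 + y) ^+ m.*2 - 1 - m.*2%:R * y)))); last first.
  apply: (@le_trans _ _ (u ^+ m.*2 * (1 + k%:R^-1) ^+ m)).
    by rewrite ler_pM2l ?exprn_gt0// binomial_remainder_le.
  rewrite um -exprMn -natr1 le_eqVlt; apply/orP; left; apply/eqP.
  by congr (_ ^+ _); field; rewrite gt_eqF.
rewrite (sum_ord_recl2 (fun i => 'C(m.*2, i)%:R *
  E (fun w => X w ^+ (m.*2 - i) * Y w ^+ i))) ?double_gt0//.
rewrite bin0 subn0 bin1 !mul1r.
have -> : E (fun w => X w ^+ (m.*2 - 1) * Y w ^+ 1) = 0.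
  by rewrite -[RHS]EXY; apply: eq_Rintegral => w _; rewrite expr1 subn1.
rewrite mulr0 add0r mulrDr mulr1 lerD//.
  by apply: le_trans EX; under eq_Rintegral do rewrite expr0 mulr1.
have -> : (1 + y) ^+ m.*2 - 1 - m.*2%:R * y =
    \sum_(i < m.*2.-1) 'C(m.*2, i.+2)%:R * y ^+ i.+2.
  rewrite exprDn (sum_ord_recl2
    (fun i => 1 ^+ (m.*2 - i) * y ^+ i *+ 'C(m.*2, i))) ?double_gt0//.
  under eq_bigr do rewrite expr1n mul1r -mulr_natl.
  rewrite bin0 bin1 !expr1n mulr1n expr1 expr0 !mul1r -[y *+ _]mulr_natl.
  by ring.
rewrite mulrCA !mulr_sumr; apply: ler_sum => i _.
rewrite [leRHS](_ : _ =
  'C(m.*2, i.+2)%:R * (2 * (u ^+ m.*2 * y ^+ i.+2))); last by ring.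
rewrite ler_wpM2l//.
have im : (i.+2 <= m.*2)%N by have := ltn_ord i; lia.
apply: (le_trans (mixed_moment_le aX aY u0 A0 im EX EY)).
have -> : u ^+ m.*2 = u ^+ (m.*2 - i.+2) * u ^+ i.+2 by rewrite -exprD subnK.
rewrite ler_pM2l// -mulrA ler_pM2l ?exprn_gt0//.
by rewrite /y expr_div_n mulrC divfK// expf_neq0 ?gt_eqF.
Qed.

(** A moment inequality of Marcinkiewicz-Zygmund type for sums whose terms are
    orthogonal to the odd powers of the preceding partial sums.  The increments
    are enumerated by an injective key [f], which makes it applicable to sums
    over double indices without flattening them into a sequence. *)
Lemma orthogonal_moment_le (I : finType) (f : I -> nat) (D : I -> Om -> R)
    (m : nat) (A : R) :
  injective f -> (0 < m)%N -> 0 < A ->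
  (forall i, all_moments (D i)) ->
  (forall i, E (fun w => D i w ^+ m.*2) <= A ^+ m.*2) ->
  (forall i, E (fun w => (\sum_(j | (f j < f i)%N) D j w) ^+ m.*2.-1 * D i w)
     = 0) ->
  E (fun w => (\sum_j D j w) ^+ m.*2) <= (96 * m%:R * #|I|%:R * A ^+ 2) ^+ m.
Proof.
move=> finj m0 A0 aD ED orth.
pose S k w := \sum_(j | (f j < k)%N) D j w.
pose card k := #|[pred j | (f j < k)%N]|.
have step k : E (fun w => S k w ^+ m.*2) <=
    (96 * m%:R * (card k)%:R * A ^+ 2) ^+ m.
  elim: k => [|k ih].
    rewrite /S; under eq_Rintegral do rewrite big_pred0_eq expr0n.
    have -> : (m.*2 == 0)%N = false by case: (m) m0.
    by rewrite [leLHS](mean_cst 0) /card exprn_ge0// !mulr_ge0 ?ler0n ?ltW.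
  have [i fi|nf] := pickP (fun i => f i == k); last first.
    have e j : (f j < k.+1)%N = (f j < k)%N.
      by rewrite ltnS leq_eqVlt nf.
    have -> : card k.+1 = card k by apply: eq_card => j; rewrite !inE e.
    by rewrite /S; under eq_fun do under eq_bigl do rewrite e.
  have e j : (f j < k.+1)%N = (j == i) || (f j < k)%N.
    by rewrite ltnS leq_eqVlt -(eqP fi) (inj_eq finj).
  have ni : (f i < k)%N = false by rewrite (eqP fi) ltnn.
  have -> : card k.+1 = (card k).+1.
    rewrite /card (cardD1 i) inE /= (eqP fi) ltnSn add1n; congr (_.+1).
    apply: eq_card => j; rewrite !inE e.
    by have [->|//] := eqVneq j i; rewrite ni.
  have Sk w : S k.+1 w = S k w + D i w.
    rewrite /S (bigD1 i) /= ?(eqP fi)// addrC; congr (_ + _).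
    by apply: eq_bigl => j; rewrite e; have [->|//=] := eqVneq j i; rewrite ?ni// andbT.
  under eq_Rintegral do rewrite Sk.
  have aS : all_moments (S k) by apply: all_moments_sum.
  have [c0|c0] := posnP (card k).
    have S0 w : S k w = 0.
      by rewrite /S big_pred0// => j; have := card0_eq c0 j; rewrite inE.
    under eq_Rintegral do rewrite S0 add0r.
    apply: (le_trans (ED i)).
    rewrite c0 mulr1 -mul2n exprM lerXn2r ?nnegrE ?sqr_ge0//.
      by rewrite !mulr_ge0 ?ler0n ?ltW.
    rewrite ler_peMl ?sqr_ge0//.
    have : 1 <= m%:R :> R by rewrite ler1n.
    lra.
  apply: orthogonal_moment_step => //.
  by rewrite -(orth i) (eqP fi).
pose M := (\max_j f j).+1.
have fM j : (f j < M)%N by rewrite ltnS leq_bigmax.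
have := step M; have -> : card M = #|I|.
  by apply: eq_card => j; rewrite !inE fM.
by rewrite /S; under eq_Rintegral do under eq_bigl do rewrite fM.
Qed.

End Moments.

(** * Tail bounds from moments *)

Lemma expR1_le4 (R : realType) : expR 1 <= 4 :> R.
Proof.
have h := expR_half_mul_le1 (1 : R).
have -> : expR 1 = expR (1 / 2) * expR (1 / 2) :> R by rewrite -expRD; congr expR; lra.
have := expR_gt0 (1 / 2 : R); nra.
Qed.

Section Tails.
Context {d : measure_display} {Om : measurableType d} {R : realType}.
Variable P : probability Om R.
Implicit Types (X Y : Om -> R).

Local Notation E X := (Rintegral P setT X).

Lemma measurable_ge_norm X (r : R) : measurable_fun setT X ->
  measurable [set w | r <= `|X w|].
Proof.
move=> mX; have mn : measurable_fun setT (fun w => `|X w|).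
  exact: measurableT_comp mX.
have := measurable_fun_ler (measurable_cst r) mn.
move=> /(_ measurableT [set true] I); rewrite setTI.
by congr (measurable _); apply/seteqP; split => w /=.
Qed.

Lemma measurable_gt_norm X (r : R) : measurable_fun setT X ->
  measurable [set w | r < `|X w|].
Proof.
move=> mX; have mn : measurable_fun setT (fun w => `|X w|).
  exact: measurableT_comp mX.
have := measurable_fun_ltr (measurable_cst r) mn.
move=> /(_ measurableT [set true] I); rewrite setTI.
by congr (measurable _); apply/seteqP; split => w /=.
Qed.

Lemma mean_EFin X : all_moments P X -> (\int[P]_w (X w)%:E)%E = (E X)%:E.
Proof. by move=> /all_moments_integrable iX; rewrite fineK// integrable_fin_num. Qed.

Lemma markov_even X (r : R) (m : nat) : all_moments P X -> 0 < r ->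
  (P [set w | (r <= `|X w|)%R] <= (E (fun w => X w ^+ m.*2) / r ^+ m.*2)%:E)%E.
Proof.
move=> aX r0.
pose X' : {mfun Om >-> R} := mfun_Sub (mem_set (all_moments_measurable aX)).
have := @markov _ _ _ P X' (fun x => x ^+ m.*2) r r0 _ _ _.
rewrite unlock /= => h.
rewrite EFinM lee_pdivlMr ?exprn_gt0// muleC -mean_EFin; last exact: all_momentsX.
apply: le_trans (h _ _ _) _.
- exact: exprn_measurable.
- by move=> x x0; rewrite exprn_ge0.
- by move=> x y; rewrite !nnegrE => x0 y0 xy; rewrite lerXn2r.
- by rewrite le_eqVlt; apply/orP; left; apply/eqP; apply: eq_integral => w _;
    rewrite /= normX_even.
Qed.

(** Chebyshev's inequality of the order [2m] with [m] the integer part of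
    [theta L]: the ratio [B m^3 n / r^2] is then at most [B theta^3 <= 1/e], so
    that its [m]-th power is at most [e^-m]. *)
Lemma tail_of_moments X (B L n r : R) :
  all_moments P X -> 0 <= B -> 0 < n -> 0 <= L -> 0 <= r -> r ^+ 2 = n * L ^+ 3 ->
  (forall m, (0 < m)%N ->
    E (fun w => X w ^+ m.*2) <= (B * m%:R ^+ 3 * n) ^+ m) ->
  (P [set w | (r < `|X w|)%R] <= (expR (1 - (1 + 4 * B)^-1 * L))%:E)%E.
Proof.
move=> aX B0 n0 L0 r0 r2 mom.
set th := (1 + 4 * B)^-1.
have th0 : 0 < th by rewrite invr_gt0; lra.
have thB : th * (1 + 4 * B) = 1 by rewrite mulVf//; lra.
have th1 : th <= 1 by nra.
have mS := measurable_gt_norm r (all_moments_measurable aX).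
have thL : 0 <= th * L by rewrite mulr_ge0// ltW.
have /andP[mle mgt] := truncn_itv thL.
set m := Num.truncn (th * L) in mle mgt.
have [m0|m0] := posnP m.
  apply: (le_trans (probability_le1 P mS)).
  rewrite lee_fin; apply: le_trans (expR_ge1Dx _).
  by rewrite m0 in mgt; lra.
have m1 : 1 <= m%:R :> R by rewrite ler1n.
have Lp : 0 < L.
  rewrite lt_neqAle L0 andbT; apply/eqP => L00.
  by move: mle; rewrite -L00 mulr0; lra.
have rp : 0 < r.
  rewrite lt_neqAle r0 andbT; apply/eqP => r00; move: r2; rewrite -r00 expr0n /=.
  by move=> /esym/eqP; rewrite gt_eqF// mulr_gt0// exprn_gt0.
apply: (@le_trans _ _ (P [set w | (r <= `|X w|)%R])).
  have mX := all_moments_measurable aX.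
  apply: le_measure; rewrite ?inE; [exact: measurable_gt_norm|
    exact: measurable_ge_norm|by move=> w /= /ltW].
apply: (le_trans (markov_even m aX rp)); rewrite lee_fin.
rewrite ler_pdivrMr ?exprn_gt0//; apply: (le_trans (mom m m0)).
apply: (@le_trans _ _ (expR (- m%:R) * r ^+ m.*2)); last first.
  by rewrite ler_wpM2r ?exprn_ge0// ler_expR; rewrite -natr1 in mgt; lra.
rewrite -mul2n exprM -[- m%:R]mulr1 mulNr -mulrN expRM_natl -exprMn r2.
have h3 : expR (-1) >= 1 / 4 :> R.
  rewrite expRN ler_pdivrMr// mulrC ler_pdivlMr ?expR_gt0// mul1r.
  exact: expR1_le4.
apply: lerXn2r; rewrite ?nnegrE.
- by rewrite !mulr_ge0// ?exprn_ge0// ltW.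
- by rewrite !mulr_ge0 ?expR_ge0 ?exprn_ge0// ltW.
have hL : m%:R ^+ 3 <= th * L ^+ 3.
  apply: (@le_trans _ _ ((th * L) ^+ 3)); first by rewrite lerXn2r// nnegrE.
  rewrite exprMn ler_wpM2r ?exprn_ge0//; nra.
rewrite [leRHS]mulrCA [leLHS]mulrC ler_pM2l//.
apply: (@le_trans _ _ (B * (th * L ^+ 3))); first by rewrite ler_wpM2l.
rewrite mulrA ler_wpM2r ?exprn_ge0//; apply: le_trans h3; nra.
Qed.

End Tails.

(** * Moments of sub-Gaussian variables *)

Section Subgaussian.
Context {R : realType}.
Variables C K : R.

Definition subgaussian_tail d (Om : measurableType d) (P : probability Om R)
    (X : Om -> R) : Prop :=
  measurable_fun setT X /\ forall u, 0 < u ->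
    (P [set w | (u <= `|X w|)%R] <= (2^-1 * K * expR (- C * u ^+ 2))%:E)%E.

(** The value at [theta = C/2] of the bound
    [sum_k e^(theta (k+1)) P(k <= X^2) <= e^theta (1+K) / (1 - e^-theta)]
    for [E e^(theta X^2)]. *)
Definition subgaussian_exp_bound : R :=
  expR (C / 2) * ((1 + K) / (1 - expR (- (C / 2)))).

Definition subgaussian_scale : R := subgaussian_exp_bound / (C / 2).

Hypotheses (C0 : 0 < C) (K0 : 0 < K).

Let q0 : 0 < expR (- (C / 2)). Proof. exact: expR_gt0. Qed.

Let q1 : expR (- (C / 2)) < 1.
Proof. by rewrite expR_lt1 oppr_lt0 divr_gt0. Qed.

Lemma subgaussian_exp_bound_ge1 : 1 <= subgaussian_exp_bound.
Proof.
rewrite /subgaussian_exp_bound; apply: (@le_trans _ _ (1 * 1)); first by rewrite mulr1.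
apply: ler_pM => //; first by rewrite -expR0 ler_expR divr_ge0// ltW.
by rewrite ler_pdivlMr ?subr_gt0 ?q1//; move: q0 K0; lra.
Qed.

Lemma subgaussian_scale_gt0 : 0 < subgaussian_scale.
Proof.
by rewrite !divr_gt0// (lt_le_trans ltr01)// subgaussian_exp_bound_ge1.
Qed.

Lemma powX_le_fact_expR (y t : R) m : 0 < t -> 0 <= y ->
  y ^+ m <= m`!%:R / t ^+ m * expR (t * y).
Proof.
move=> t0 y0; rewrite mulrAC ler_pdivlMr ?exprn_gt0//.
have f0 : 0 < m`!%:R :> R by rewrite ltr0n fact_gt0.
rewrite -exprMn [y * t]mulrC [leRHS]mulrC -ler_pdivrMr//.
case: m f0 => [|m] f0; first by rewrite expr0 fact0 divr1 -expR0 ler_expR mulr_ge0// ltW.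
have ty : 0 <= t * y by rewrite mulr_ge0// ltW.
by have := expR_ge1Dxn m ty; lra.
Qed.

Variables (d : measure_display) (Om : measurableType d).
Variables (P : probability Om R) (X : Om -> R).
Hypothesis tailX : subgaussian_tail P X.

Let level k := [set w | Num.sqrt k%:R <= `|X w|].

Let level_measurable k : measurable (level k).
Proof. by apply: measurable_ge_norm; case: tailX. Qed.

Lemma subgaussian_level_le k :
  (P (level k) <= ((1 + K) * expR (- (C / 2)) ^+ k * expR (- (C / 2 * k%:R)))%:E)%E.
Proof.
have [->|k0] := posnP k.
  rewrite expr0 mulr0 oppr0 expR0 !mulr1.
  by rewrite (le_trans (probability_le1 _ (level_measurable _)))// lee_fin; move: K0; lra.
case: tailX => _ /(_ (Num.sqrt k%:R)); rewrite sqrtr_gt0 ltr0n k0 => /(_ isT) h.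
apply: (le_trans h); rewrite lee_fin sqr_sqrtr//.
rewrite -[leRHS]mulrA -expRM_natr -expRD; have -> : - (C / 2) * k%:R + - (C / 2 * k%:R) = - C * k%:R by field.
by have := expR_gt0 (- C * k%:R); move: K0; nra.
Qed.

Lemma subgaussian_even_moment_le m :
  (\int[P]_w (X w ^+ m.*2)%:E <=
    (m`!%:R / (C / 2) ^+ m * subgaussian_exp_bound)%:E)%E.
Proof.
have mX : measurable_fun setT X by case: tailX.
have even0 (w : Om) : 0 <= X w ^+ m.*2 by rewrite -normX_even exprn_ge0.
pose g k w : \bar R := ((k.+1%:R ^+ m) * \1_(level k) w)%:E.
have g0 k w : (0 <= g k w)%E by rewrite lee_fin mulr_ge0// exprn_ge0.
have mg k : measurable_fun setT (g k).
  by apply/measurable_EFinP; apply: measurable_funM => //; exact: measurable_indic.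
apply: (@le_trans _ _ (\int[P]_w (\sum_(0 <= k <oo) g k w))%E).
  apply: ge0_le_integral => //.
  - by move=> w _; rewrite lee_fin.
  - by apply/measurable_EFinP; exact: measurable_funX.
  - exact: ge0_emeasurable_sum.
  move=> w _; pose k := Num.truncn (X w ^+ 2).
  have /andP[k1 k2] := truncn_itv (sqr_ge0 (X w)).
  apply: le_trans (@nneseries_lim_ge _ (fun k => g k w) xpredT 0 k.+1 _) => //.
  rewrite big_nat_recr//=; apply: (@le_trans _ _ (g k w)).
    rewrite lee_fin indicE mem_set ?mulr1.
      by rewrite -mul2n exprM lerXn2r ?nnegrE ?sqr_ge0// ltW.
    by rewrite /level /= -sqrtr_sqr ler_sqrt ?sqr_ge0.
  by rewrite leeDr// sume_ge0.
rewrite integral_nneseries//.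
pose q : R := expR (- (C / 2)).
pose c : R := m`!%:R / (C / 2) ^+ m * expR (C / 2) * (1 + K).
have c0 : 0 <= c.
  rewrite !mulr_ge0 ?invr_ge0 ?exprn_ge0 ?expR_ge0// ?divr_ge0 ?ltW//.
  by move: K0; lra.
have gk k : (\int[P]_w g k w <= (c * q ^+ k)%:E)%E.
  rewrite /g; under eq_integral do rewrite EFinM.
  rewrite ge0_integralZl//; last first.
    by apply/measurable_EFinP; exact: measurable_indic.
  rewrite integral_indic// setIT.
  apply: (@le_trans _ _ ((k.+1%:R ^+ m)%:E * ((1 + K) * q ^+ k * expR (- (C / 2 * k%:R)))%:E)%E).
    by rewrite lee_wpmul2l ?lee_fin ?exprn_ge0//; exact: subgaussian_level_le.
  rewrite -EFinM lee_fin.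
  have C2 : 0 < C / 2 by rewrite divr_gt0.
  have y0 : 0 <= k.+1%:R :> R by [].
  have h := powX_le_fact_expR m C2 y0.
  rewrite expRN; have e0 := expR_gt0 (C / 2 * k%:R).
  rewrite mulrA ler_pdivrMr//.
  have -> : c * q ^+ k * expR (C / 2 * k%:R) =
    (m`!%:R / (C / 2) ^+ m * expR (C / 2 * k.+1%:R)) * ((1 + K) * q ^+ k).
    rewrite (_ : C / 2 * k.+1%:R = C / 2 * k%:R + C / 2); last first.
      by rewrite -[k.+1%:R]natr1 mulrDr mulr1.
    by rewrite /c expRD; ring.
  rewrite ler_wpM2r// mulr_ge0 ?exprn_ge0 ?expR_ge0//.
  by move: K0; lra.
apply: (@le_trans _ _ (\sum_(0 <= k <oo) (c * q ^+ k)%:E)%E).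
  by apply: lee_nneseries => [k _ _|k _]; [exact: integral_ge0|exact: gk].
apply: lime_le.
  by apply: is_cvg_nneseries => k _ _; rewrite lee_fin mulr_ge0// exprn_ge0// ltW.
apply: nearW => n; rewrite sumEFin lee_fin.
have -> : m`!%:R / (C / 2) ^+ m * subgaussian_exp_bound = c / (1 - q).
  by rewrite /c /subgaussian_exp_bound /q; ring.
have := @geometric_le_lim R n c q c0 q0; rewrite ger0_norm ?(ltW q0)// => /(_ q1).
by rewrite /series /=.
Qed.

Lemma subgaussian_all_moments : all_moments P X.
Proof.
case: (tailX) => mX _; apply: all_moments_even => // m m0.
apply/integrableP; split; first by apply/measurable_EFinP; exact: measurable_funX.
rewrite (eq_integral (fun w => (X w ^+ m.*2)%:E)).
  exact: le_lt_trans (subgaussian_even_moment_le m) (ltry _).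
by move=> w _; rewrite /= ger0_norm// -normX_even exprn_ge0.
Qed.

Lemma subgaussian_moment_le m : (0 < m)%N ->
  Rintegral P setT (fun w => X w ^+ m.*2) <= (subgaussian_scale * m%:R) ^+ m.
Proof.
move=> m0; have := subgaussian_even_moment_le m.
rewrite mean_EFin; last by apply: all_momentsX; exact: subgaussian_all_moments.
rewrite lee_fin => /le_trans; apply.
have H1 := subgaussian_exp_bound_ge1; have H0 := lt_le_trans ltr01 H1.
have C2 : 0 < C / 2 by rewrite divr_gt0.
rewrite /subgaussian_scale [in leRHS]exprMn [in leRHS]expr_div_n.
rewrite [leRHS](_ : _ = (m%:R ^+ m / (C / 2) ^+ m) * subgaussian_exp_bound ^+ m); last first.
  by rewrite mulrC [RHS]mulrAC mulrA.
apply: ler_pM; rewrite ?divr_ge0 ?exprn_ge0 ?(ltW H0) ?(ltW C2)//.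
  by rewrite ler_wpM2r ?fact_le_exp// invr_ge0 exprn_ge0// ltW.
by rewrite ler_eXnr.
Qed.

End Subgaussian.

(** * Orthogonality to a sigma-algebra *)

Section Orthogonality.
Import HBNNSimple.
Context {d : measure_display} {Om : measurableType d} {R : realType}.
Variable P : probability Om R.
Implicit Types (X Y h : Om -> R) (G : set_system Om) (A F : set Om).

(** The domain is retyped with its smaller sigma-algebra, so that the closure
    properties of measurable functions apply to [h] as they stand. *)
Definition sigma_measurable G h : Prop :=
  measurable_fun (setT : set (g_sigma_algebraType G)) (h : _ -> R).

Lemma sigma_sub_measurable G : G `<=` measurable -> <<s G >> `<=` measurable.
Proof.
move=> GM; apply: smallest_sub => //; split => //.
- by move=> A mA; rewrite setTD; exact: measurableC.
- by move=> F mF; exact: bigcupT_measurable.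
Qed.

Lemma sigma_measurable_fun G h : G `<=` measurable -> sigma_measurable G h ->
  measurable_fun setT h.
Proof.
move=> GM mh _ B mB; have := mh measurableT B mB.
exact: sigma_sub_measurable.
Qed.

Lemma zero_integral_sigma G Y : G `<=` measurable -> setI_closed G -> G setT ->
  P.-integrable setT (EFin \o Y) ->
  (forall A, G A -> (\int[P]_(w in A) (Y w)%:E = 0)%E) ->
  forall A, <<s G >> A -> (\int[P]_(w in A) (Y w)%:E = 0)%E.
Proof.
move=> GM GI GT iY Y0.
have GsM := sigma_sub_measurable GM.
have intS A : measurable A -> P.-integrable A (EFin \o Y).
  by move=> mA; apply: (integrableS measurableT mA _ iY).
have mY : measurable_fun setT Y by apply/measurable_EFinP; exact: measurable_int iY.
apply: (@dynkin_induction _ (g_sigma_algebraType G) G) => //.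
- exact: Y0.
- move=> A sA A0; have mA : d.-measurable (A : set Om) by exact: GsM.
  have := Y0 _ GT; rewrite -(setUv A) integral_setU_EFin//.
  + by rewrite A0 add0e.
  + exact: measurableC.
  + by rewrite setUv.
  + by rewrite disj_set2E setICr.
- move=> F sF tF F0.
  have mF n : d.-measurable (F n : set Om) by exact: (GsM _ (sF n)).
  rewrite integral_bigcup//; last by apply: intS; exact: bigcupT_measurable.
  by apply: eseries0 => i _ _; exact: F0.
Qed.

Lemma orthogonal_simple G Y (g : {nnsfun g_sigma_algebraType G >-> R}) :
  G `<=` measurable -> P.-integrable setT (EFin \o Y) ->
  (forall A, <<s G >> A -> (\int[P]_(w in A) (Y w)%:E = 0)%E) ->
  (\int[P]_w ((g w * Y w)%:E) = 0)%E.
Proof.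
move=> GM iY Y0.
have GsM := sigma_sub_measurable GM.
have sg y : <<s G >> (g @^-1` [set y]) by exact: (measurable_sfunP g).
have mg y : measurable (g @^-1` [set y] : set Om) by exact: GsM.
have e w : (g w * Y w)%:E =
    (\sum_(y <- finmap.enum_fset (fset_set (range g)))
      (y%:E * (EFin \o Y \_ (g @^-1` [set y])) w))%E.
  rewrite (fimfunE g w) fsbig_finite//= mulr_suml -sumEFin.
  apply: eq_bigr => y _; rewrite -EFinM; congr EFin.
  rewrite -mulrA; congr (_ * _); rewrite patchE indicE.
  by case: ifPn => _; rewrite ?mul1r ?mul0r.
under eq_integral do rewrite e.
have iA y : P.-integrable setT (EFin \o Y \_ (g @^-1` [set y])).
  rewrite -restrict_EFin; apply/(integrable_mkcond _ (mg y)).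
  exact: (integrableS measurableT (mg y) _ iY).
rewrite integral_sum//; last by move=> y; exact: integrableZl.
rewrite big1// => y _; rewrite integralZl//.
rewrite -restrict_EFin -integral_mkcond.
by rewrite [X in (_ * X)%E](Y0 _ (sg y)) mule0.
Qed.

Lemma orthogonal_ge0 G Y h :
  G `<=` measurable -> P.-integrable setT (EFin \o Y) ->
  (forall A, <<s G >> A -> (\int[P]_(w in A) (Y w)%:E = 0)%E) ->
  sigma_measurable G h -> (forall w, 0 <= h w) ->
  P.-integrable setT (EFin \o (fun w => h w * Y w)) ->
  (\int[P]_w ((h w * Y w)%:E) = 0)%E.
Proof.
move=> GM iY Y0 mh h0 ihY.
have mhE : measurable_fun (setT : set (g_sigma_algebraType G)) (EFin \o h).
  exact/measurable_EFinP.
pose g n := nnsfun_approx (measurableT : measurable (setT : set (g_sigma_algebraType G))) mhE n.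
have gh w : (g n w)%:E @[n --> \oo] --> (h w)%:E.
  by apply: (cvg_nnsfun_approx measurableT mhE) => // v _; rewrite lee_fin.
have gle n w : g n w <= h w.
  have gr : g n w @[n --> \oo] --> h w by exact: (fine_cvg (gh w)).
  rewrite -(cvg_lim _ gr)//; apply: nondecreasing_cvgn_le; last exact: cvgP gr.
  move=> i j ij.
  by have /lefP := nd_nnsfun_approx measurableT mhE ij; apply.
have mY : measurable_fun setT Y by apply/measurable_EFinP; exact: measurable_int iY.
have mg n : measurable_fun setT (g n : Om -> R).
  by apply: (sigma_measurable_fun GM); exact: measurable_funP.
have mhY := measurable_funM (sigma_measurable_fun GM mh) mY.
have [] := @dominated_convergence _ _ _ P setT measurableT
  (fun n w => (g n w * Y w)%:E) (fun w => (h w * Y w)%:E)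
  (fun w => `|h w * Y w|%:E).
- by move=> n; apply/measurable_EFinP; exact: measurable_funM.
- exact/measurable_EFinP.
- apply: aeW => w _; under eq_fun do rewrite EFinM.
  by rewrite EFinM; apply: cvgeZr => //; exact: gh.
- exact: integrable_norm ihY.
- apply: aeW => w n _; rewrite lee_fin !normrM ler_wpM2r//.
  by rewrite !ger0_norm ?gle.
move=> _ _ /=.
under eq_fun do rewrite (orthogonal_simple _ GM iY Y0).
by move=> /cvg_lim <-//; rewrite lim_cst.
Qed.

(** Passing from sets to functions: the sets on which [Y] integrates to zero form
    a Dynkin system, and the positive and negative parts of [h] are monotone
    limits of simple functions, dominated by [|h|]. *)
Lemma orthogonal_measurable G Y h :
  G `<=` measurable -> setI_closed G -> G setT ->
  P.-integrable setT (EFin \o Y) ->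
  (forall A, G A -> (\int[P]_(w in A) (Y w)%:E = 0)%E) ->
  sigma_measurable G h -> P.-integrable setT (EFin \o (fun w => h w * Y w)) ->
  (\int[P]_w ((h w * Y w)%:E) = 0)%E.
Proof.
move=> GM GI GT iY Y0G mh ihY.
have Y0 := zero_integral_sigma GM GI GT iY Y0G.
have mY : measurable_fun setT Y by apply/measurable_EFinP; exact: measurable_int iY.
have mh' := sigma_measurable_fun GM mh.
pose hp w : R := Num.max (h w) 0; pose hn w : R := Num.max (- h w) 0.
have mhp : sigma_measurable G hp by exact: measurable_maxr.
have mhn : sigma_measurable G hn.
  by apply: measurable_maxr => //; exact: measurable_funN.
have bound (k : Om -> R) : measurable_fun setT k -> (forall w, `|k w| <= `|h w|) ->
    P.-integrable setT (EFin \o (fun w => k w * Y w)).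
  move=> mk kh; apply: le_integrable ihY => //.
    by apply/measurable_EFinP; exact: measurable_funM.
  by move=> w _ /=; rewrite lee_fin !normrM ler_wpM2r.
have ip : P.-integrable setT (EFin \o (fun w => hp w * Y w)).
  apply: bound; first exact: (sigma_measurable_fun GM mhp).
  by move=> w; rewrite /hp; case: (leP 0 (h w)) => hw; rewrite ?normr0.
have inn : P.-integrable setT (EFin \o (fun w => hn w * Y w)).
  apply: bound; first exact: (sigma_measurable_fun GM mhn).
  by move=> w; rewrite /hn; case: (leP (- h w) 0) => hw; rewrite ?normr0 ?normrN.
have -> : (fun w => (h w * Y w)%:E) = 
    ((EFin \o (fun w => hp w * Y w)%R) \- (EFin \o (fun w => hn w * Y w)%R))%E.
  apply/funext => w /=; rewrite -EFinB -mulrBl; congr (EFin (_ * _)).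
  by rewrite /hp /hn; case: (leP 0 (h w)) => h1; case: (leP (- h w) 0) => h2; lra.
rewrite integralB//= !(orthogonal_ge0 GM iY Y0) ?sube0//.
- by move=> w; rewrite /hn le_max lexx orbT.
- by move=> w; rewrite /hp le_max lexx orbT.
Qed.

(** An event independent of a sigma-algebra: the centred indicator of the event
    is orthogonal to that sigma-algebra, so [orthogonal_measurable] applies with
    the roles of the two factors exchanged. *)
Lemma integral_independent_event G F Y :
  G `<=` measurable -> setI_closed G -> G setT -> measurable F ->
  (forall A, G A -> (P (F `&` A) = P F * P A)%E) ->
  sigma_measurable G Y -> P.-integrable setT (EFin \o Y) ->
  (\int[P]_(w in F) (Y w)%:E = P F * \int[P]_w (Y w)%:E)%E.
Proof.
move=> GM GI GT mF ind mY iY.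
pose p := fine (P F).
have pE : P F = p%:E by rewrite fineK// fin_num_measure.
pose Z w : R := \1_F w - p.
have i1 : P.-integrable setT (EFin \o \1_F) by exact: integrable_indic.
have ic : P.-integrable setT (EFin \o cst p).
  exact: finite_measure_integrable_cst.
have ZE : EFin \o Z = ((EFin \o \1_F) \- (EFin \o cst p))%E by apply/funext.
have iZ : P.-integrable setT (EFin \o Z) by rewrite ZE; exact: integrableB.
have mY' := sigma_measurable_fun GM mY.
have i1Y : P.-integrable setT (EFin \o (fun w => Y w * \1_F w)).
  apply: le_integrable iY => //.
    by apply/measurable_EFinP; apply: measurable_funM.
  move=> w _ /=; rewrite lee_fin normrM ler_piMr//.
  by rewrite indicE; case: (_ \in _); rewrite ?normr1 ?normr0.
have ipY : P.-integrable setT (EFin \o (fun w => p * Y w)).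
  exact: (integrableZl measurableT p iY).
have YZ : EFin \o (fun w => Y w * Z w) =
    ((EFin \o (fun w => Y w * \1_F w)%R) \- (EFin \o (fun w => p * Y w)%R))%E.
  by apply/funext => w /=; rewrite -EFinB /Z mulrBr [p * _]mulrC.
have := @orthogonal_measurable G Z Y GM GI GT iZ _ mY _.
have Z0 A : G A -> (\int[P]_(w in A) (Z w)%:E = 0)%E.
  move=> GA; have mA := GM _ GA.
  rewrite (eq_integral (fun w => ((EFin \o \1_F) w - (EFin \o cst p) w)%E)); last by [].
  rewrite integralB//; [|exact: (integrableS measurableT mA _ i1)
                        |exact: (integrableS measurableT mA _ ic)].
  rewrite [X in (X - _)%E](_ : _ = (P F * P A)%E); last first.
    by rewrite integral_indic//; exact: ind.
  rewrite [X in (_ - X)%E](_ : _ = (P F * P A)%E).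
    by rewrite subee// fin_numM// fin_num_measure.
  by rewrite pE -integral_cst.
have iYZ : P.-integrable setT (EFin \o (fun w => Y w * Z w)).
  by rewrite YZ; exact: integrableB.
move=> /(_ Z0 iYZ).
rewrite (eq_integral (fun w => ((EFin \o (fun w => Y w * \1_F w)%R) w -
    (EFin \o (fun w => p * Y w)%R) w)%E)); last first.
  by move=> w _; have := congr1 (@^~ w) YZ.
rewrite integralB// => /eqP; rewrite sube_eq ?add0e; last 2 first.
- exact: integrable_fin_num.
- by rewrite fin_num_adde_defl// integrable_fin_num.
move=> /eqP e; rewrite pE -integralZl//.
rewrite [RHS](_ : _ = \int[P]_w (EFin \o (fun w => p * Y w)%R) w)%E; last by [].
rewrite -e [LHS]integral_mkcond; apply: eq_integral => w _ /=.
by rewrite patchE indicE; case: (_ \in _); rewrite ?mulr1 ?mulr0.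
Qed.

End Orthogonality.

(** * Sums of orthogonal sub-exponential variables *)

Section SubexponentialSums.
Context {d : measure_display} {Om : measurableType d} {R : realType}.
Variable P : probability Om R.
Implicit Types (X Y : Om -> R) (A a : R).

Local Notation E X := (Rintegral P setT X).

(** Equivalent, up to the value of [A], to an exponential tail. *)
Definition subexponential A X : Prop :=
  all_moments P X /\
  forall m, (0 < m)%N -> E (fun w => X w ^+ m.*2) <= (A * m%:R) ^+ m.*2.

Lemma subexponential_all_moments A X : subexponential A X -> all_moments P X.
Proof. by case. Qed.

Lemma le_subexponential A A' X : 0 <= A -> A <= A' ->
  subexponential A X -> subexponential A' X.
Proof.
move=> A0 AA [aX mX]; split=> // m m0; apply: (le_trans (mX m m0)).
by rewrite lerXn2r ?nnegrE ?mulr_ge0 ?ler_wpM2r// (le_trans A0).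
Qed.

Lemma subexponentialM a X Y : 0 <= a -> all_moments P X -> all_moments P Y ->
  (forall m, (0 < m)%N -> E (fun w => X w ^+ m.*2) <= (a * m%:R) ^+ m) ->
  (forall m, (0 < m)%N -> E (fun w => Y w ^+ m.*2) <= (a * m%:R) ^+ m) ->
  subexponential (4 * a) (fun w => X w * Y w).
Proof.
move=> a0 aX aY mX mY; split; first exact: all_momentsM.
move=> m m0.
apply: (@le_trans _ _ (E (fun w => X w ^+ m.*2.*2 + Y w ^+ m.*2.*2))).
  apply: le_mean.
  - by apply: all_momentsX; exact: all_momentsM.
  - by apply: all_momentsD; exact: all_momentsX.
  move=> w; rewrite -(normX_even (X w * Y w)) normrM exprMn.
  rewrite -2!(normX_even _ m.*2).
  have := @mulXX_le_add R `|X w| `|Y w| m.*2.*2 m.*2.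
  have -> : (m.*2.*2 - m.*2 = m.*2)%N by lia.
  by apply => //; lia.
rewrite meanD; [|exact: all_momentsX..].
have m20 : (0 < m.*2)%N by rewrite double_gt0.
apply: (@le_trans _ _ (2 ^+ m.*2 * (a * m.*2%:R) ^+ m.*2)).
  apply: (@le_trans _ _ (2 * (a * m.*2%:R) ^+ m.*2)).
    by rewrite [leRHS]mulr_natl mulr2n lerD// ?mX ?mY.
  rewrite ler_wpM2r ?exprn_ge0 ?mulr_ge0//.
  by rewrite ler_eXnr ?ler1n.
rewrite -exprMn le_eqVlt; apply/orP; left; apply/eqP; congr (_ ^+ _).
by rewrite -mul2n natrM; ring.
Qed.

Lemma subexponential_of_subgaussian a X : 0 <= a -> all_moments P X ->
  (forall m, (0 < m)%N -> E (fun w => X w ^+ m.*2) <= (a * m%:R) ^+ m) ->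
  subexponential (a + 1) X.
Proof.
move=> a0 aX mX; split=> // m m0; apply: (le_trans (mX m m0)).
rewrite -[in leRHS]mul2n exprM.
have m1 : 1 <= m%:R :> R by rewrite ler1n.
rewrite lerXn2r ?nnegrE ?mulr_ge0 ?exprn_ge0 ?mulr_ge0 ?addr_ge0//.
rewrite exprMn; apply: ler_pM => //; nra.
Qed.

Lemma subexponential_center A X : 0 <= A -> subexponential A X ->
  subexponential (4 * A) (fun w => X w - E X).
Proof.
move=> A0 [aX mX].
have ac : all_moments P (cst (- E X)) by exact: all_moments_cst.
have aC : all_moments P (fun w => X w - E X) by exact: all_momentsD.
split=> // m m0.
have EX2 : (E X) ^+ 2 <= A ^+ 2.
  have h := mX 1%N isT; rewrite mulr1 in h.
  apply: le_trans h.
  have : 0 <= E (fun w => (X w - E X) ^+ 1.*2) by exact: mean_even_ge0.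
  have -> : (fun w => (X w - E X) ^+ 1.*2) =
      (fun w => X w ^+ 1.*2 + (- (2 * E X) * X w + cst ((E X) ^+ 2) w)).
    by apply/funext => w; rewrite /= !expr2; ring.
  have aX2 := all_momentsX 1.*2 aX.
  have aXm : all_moments P (fun w => - (2 * E X) * X w).
    by apply: all_momentsM => //; exact: all_moments_cst.
  have aE : all_moments P (cst (E X ^+ 2)) by exact: all_moments_cst.
  rewrite meanD//; last exact: all_momentsD.
  rewrite meanD// meanZ// mean_cst.
  by lra.
have m1 : 1 <= m%:R :> R by rewrite ler1n.
have m20 : (0 < m.*2)%N by rewrite double_gt0.
have EXm : (E X) ^+ m.*2 <= (A * m%:R) ^+ m.*2.
  rewrite -mul2n !exprM lerXn2r ?nnegrE ?sqr_ge0//.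
  by apply: (le_trans EX2); rewrite exprMn ler_peMr ?sqr_ge0// exprn_ege1.
apply: (@le_trans _ _
    (E (fun w => 2 ^+ m.*2 * (X w ^+ m.*2) + cst (2 ^+ m.*2 * (E X) ^+ m.*2) w))).
  have aXm := all_momentsX m.*2 aX.
  apply: le_mean; first exact: all_momentsX.
    apply: all_momentsD; last exact: all_moments_cst.
    by apply: all_momentsM => //; exact: all_moments_cst.
  move=> w /=; rewrite -[leLHS]normX_even -mulrDr.
  apply: (@le_trans _ _ ((2 * Num.max `|X w| `|E X|) ^+ m.*2)).
    rewrite lerXn2r ?nnegrE ?mulr_ge0// ?le_max ?normr_ge0//.
    by rewrite (le_trans (ler_normB _ _))// mulr_natl mulr2n lerD// le_max lexx ?orbT.
  rewrite exprMn ler_wpM2l ?exprn_ge0//.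
  have e0 y : 0 <= y ^+ m.*2 :> R by rewrite -normX_even exprn_ge0.
  by have [_|_] := leP `|X w| `|E X|; rewrite normX_even ?lerDl ?lerDr.
have aXm := all_momentsX m.*2 aX.
have aXm2 : all_moments P (fun w => 2 ^+ m.*2 * X w ^+ m.*2).
  by apply: all_momentsM => //; exact: all_moments_cst.
rewrite meanD//; last exact: all_moments_cst.
rewrite mean_cst meanZ//.
rewrite -mulrDr; apply: (@le_trans _ _ (2 ^+ m.*2 * (2 * (A * m%:R) ^+ m.*2))).
  by rewrite ler_wpM2l ?exprn_ge0// [leRHS]mulr_natl mulr2n lerD// mX.
have -> : 4 * A * m%:R = 2 * (2 * (A * m%:R)) by ring.
rewrite [leRHS]exprMn ler_wpM2l ?exprn_ge0// [leRHS]exprMn.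
by rewrite ler_wpM2r ?exprn_ge0 ?mulr_ge0// ler_eXnr ?ler1n.
Qed.

Definition tail_rate A : R := (1 + 4 * (96 * A ^+ 2))^-1.

Lemma tail_rate_gt0 A : 0 < tail_rate A.
Proof. by rewrite invr_gt0; have := sqr_ge0 A; lra. Qed.

(** With [m^2] from the sub-exponential increments and [m] from the orthogonal
    summation the [2m]-th moment is at most [(B m^3 n)^m]; this is where the
    cubes of the logarithms in the tuning parameters come from. *)
Lemma orthogonal_sum_tail (I : finType) (f : I -> nat) (D : I -> Om -> R)
    (A L r : R) :
  injective f -> (0 < #|I|)%N -> 0 < A -> 0 <= L -> 0 <= r ->
  r ^+ 2 = #|I|%:R * L ^+ 3 ->
  (forall i, subexponential A (D i)) ->
  (forall m i, (0 < m)%N ->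
    E (fun w => (\sum_(j | (f j < f i)%N) D j w) ^+ m.*2.-1 * D i w) = 0) ->
  (P [set w | (r < `|\sum_i D i w|)%R] <= (expR (1 - tail_rate A * L))%:E)%E.
Proof.
move=> finj I0 A0 L0 r0 r2 sD orth.
apply: (tail_of_moments (n := #|I|%:R)) => //.
- by apply: all_moments_sum => i _; exact: subexponential_all_moments (sD i).
- by rewrite mulr_ge0 ?sqr_ge0.
- by rewrite ltr0n.
move=> m m0; have mp : 0 < m%:R :> R by rewrite ltr0n.
apply: le_trans (orthogonal_moment_le (f := f) (A := A * m%:R) finj m0 _ _ _ _) _ => //.
- by rewrite mulr_gt0.
- by move=> i; exact: subexponential_all_moments (sD i).
- by move=> i; case: (sD i) => _; apply.
- by move=> i; exact: orth.
by rewrite le_eqVlt; apply/orP; left; apply/eqP; congr (_ ^+ _); ring.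
Qed.

End SubexponentialSums.

(** * Orthogonality in the panel *)

Section Preimages.
Context {d d' : measure_display} {Om : measurableType d} {S : measurableType d'}.
Implicit Types (f : Om -> S).

Definition preimages f : set_system Om :=
  [set A | exists2 B, measurable B & A = f @^-1` B].

Lemma preimages_measurable f : measurable_fun setT f ->
  preimages f `<=` measurable.
Proof. by move=> mf _ [B mB ->]; rewrite -[_ @^-1` _]setTI; exact: mf. Qed.

Lemma preimages_setI f : setI_closed (preimages f).
Proof.
move=> _ _ [B mB ->] [B' mB' ->]; exists (B `&` B'); first exact: measurableI.
by rewrite preimage_setI.
Qed.

Lemma preimages_setT f : preimages f setT.
Proof. by exists setT => //; rewrite preimage_setT. Qed.

Lemma sigma_measurable_preimages (R : realType) f (g : S -> R) :
  measurable_fun setT g -> sigma_measurable (preimages f) (g \o f).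
Proof.
move=> mg _ B mB; rewrite setTI comp_preimage.
apply: sub_gen_smallest; exists (g @^-1` B) => //.
by rewrite -[_ @^-1` _]setTI; exact: mg.
Qed.

End Preimages.

Lemma sigma_measurable_sub {d} {Om : measurableType d} {R : realType}
    (G G' : set_system Om) (h : Om -> R) :
  G `<=` <<s G' >> -> sigma_measurable G h -> sigma_measurable G' h.
Proof.
move=> GG mh _ B mB; have := mh measurableT B mB; rewrite setTI.
move: (h @^-1` B); apply: smallest_sub => //.
exact: smallest_sigma_algebra.
Qed.

Section PanelOrthogonality.
Context {d : measure_display} {Om : measurableType d} {R : realType}.
Context {P : probability Om R} {N T p : nat}.
Variables (x : 'I_N -> 'I_T -> 'I_p -> {RV P >-> R}).
Variables (eps : 'I_N -> 'I_T -> {RV P >-> R}).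
Hypothesis A1 : assumption_A1 x eps.

Definition unit_data (i : 'I_N) (w : Om) := (X_tuple x i w, eps_tuple eps i w).

Lemma measurable_X_tuple i : measurable_fun setT (X_tuple x i).
Proof.
apply/measurable_fun_tnthP => t; apply/measurable_fun_tnthP => k.
rewrite (_ : _ \o _ = x i t k) //.
by apply/funext => w; rewrite /= !tnth_mktuple.
Qed.

Lemma measurable_eps_tuple i : measurable_fun setT (eps_tuple eps i).
Proof.
apply/measurable_fun_tnthP => t.
rewrite (_ : _ \o _ = eps i t) //.
by apply/funext => w; rewrite /= !tnth_mktuple.
Qed.

Lemma measurable_unit_data i : measurable_fun setT (unit_data i).
Proof.
by apply: measurable_fun_pair; [exact: measurable_X_tuple|exact: measurable_eps_tuple].
Qed.

Lemma sigma_unit_data_x i t k : sigma_measurable (preimages (unit_data i)) (x i t k).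
Proof.
have := @sigma_measurable_preimages _ _ _ _ R (unit_data i)
  (fun v => tnth (tnth v.1 t) k) _.
rewrite (_ : _ \o _ = x i t k); last by apply/funext => w; rewrite /= !tnth_mktuple.
by apply; exact: (measurableT_comp (measurable_tnth k)
  (measurableT_comp (measurable_tnth t) measurable_fst)).
Qed.

Lemma sigma_unit_data_eps i t : sigma_measurable (preimages (unit_data i)) (eps i t).
Proof.
have := @sigma_measurable_preimages _ _ _ _ R (unit_data i)
  (fun v => tnth v.2 t) _.
rewrite (_ : _ \o _ = eps i t); last by apply/funext => w; rewrite /= !tnth_mktuple.
by apply; exact: (measurableT_comp (measurable_tnth t) measurable_snd).
Qed.

Lemma sigma_X_tuple_x i t k : sigma_measurable (preimages (X_tuple x i)) (x i t k).
Proof.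
have := @sigma_measurable_preimages _ _ _ _ R (X_tuple x i)
  (fun v => tnth (tnth v t) k) _.
rewrite (_ : _ \o _ = x i t k); last by apply/funext => w; rewrite /= !tnth_mktuple.
by apply; exact: (measurableT_comp (measurable_tnth k) (measurable_tnth t)).
Qed.

Lemma sigma_eps_tuple_eps i t : sigma_measurable (preimages (eps_tuple eps i)) (eps i t).
Proof.
have := @sigma_measurable_preimages _ _ _ _ R (eps_tuple eps i)
  (fun v => tnth v t) _.
rewrite (_ : _ \o _ = eps i t); last by apply/funext => w; rewrite /= !tnth_mktuple.
by apply; exact: measurable_tnth.
Qed.

Definition other_units (i : 'I_N) : set_system Om :=
  [set F | exists A : 'I_N -> set (T.-tuple (p.-tuple R) * T.-tuple R)%type,
    [/\ forall i', measurable (A i'), A i = setT &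
        F = \bigcap_i' (unit_data i' @^-1` A i')]].

Lemma other_units_measurable i : other_units i `<=` measurable.
Proof.
move=> _ [A [mA _ ->]]; apply: fin_bigcap_measurable => // i' _.
by rewrite -[_ @^-1` _]setTI; exact: measurable_unit_data.
Qed.

Lemma other_units_setI i : setI_closed (other_units i).
Proof.
move=> _ _ [A [mA Ai ->]] [B [mB Bi ->]]; exists (fun i' => A i' `&` B i'); split.
- by move=> i'; exact: measurableI.
- by rewrite Ai Bi setTI.
- by rewrite -bigcapI.
Qed.

Lemma other_units_setT i : other_units i setT.
Proof.
exists (fun=> setT); split => //.
by rewrite bigcapT// => i' _; rewrite preimage_setT.
Qed.

Lemma other_units_preimages i i' : i' != i -> preimages (unit_data i') `<=` other_units i.
Proof.
move=> ii _ [B mB ->]; exists (fun j => if j == i' then B else setT); split.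
- by move=> j; case: ifP.
- by rewrite eq_sym (negbTE ii).
- apply/seteqP; split => [w Bw j _|w /(_ i' I)]; rewrite /= ?eqxx//.
  by case: ifP => // /eqP ->.
Qed.

Lemma independent_other_units i F : other_units i F ->
  forall A, preimages (unit_data i) A -> (P (F `&` A) = P F * P A)%E.
Proof.
case: A1 => ind _ _ _ [A [mA Ai ->]] _ [B mB ->].
pose A' j := if j == i then B else A j.
have mA' j : measurable (A' j) by rewrite /A'; case: ifP.
have -> : \bigcap_i' (unit_data i' @^-1` A i') `&` unit_data i @^-1` B =
    \bigcap_i' (unit_data i' @^-1` A' i').
  apply/seteqP; split => [w [Aw Bw] j _|w A'w].
    by rewrite /A' /=; case: ifP => [/eqP ->//|_]; exact: Aw.
  split => [j _|]; last by have := A'w i I; rewrite /A' /= eqxx.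
  have := A'w j I; rewrite /A' /=; case: ifP => [/eqP ->|//].
  by rewrite Ai.
rewrite (ind _ mA') (ind _ mA) (bigD1 i)//= [in RHS](bigD1 i)//=.
rewrite {1}/A' eqxx Ai preimage_setT probability_setT mul1e muleC.
by congr (_ * _)%E; apply: eq_bigr => j ji; rewrite /A' (negbTE ji).
Qed.

(** The pi-system generating everything that precedes [eps i t]: the other
    units, the covariates of unit [i] at all times, and the earlier errors of
    unit [i]. *)
Definition past (i : 'I_N) (t : 'I_T) : set_system Om :=
  [set A | exists F H E, [/\ other_units i F, preimages (X_tuple x i) H,
    strict_past (fun t => eps i t) t E & A = F `&` (H `&` E)]].

Lemma strict_past_sub i t :
  strict_past (fun t => eps i t) t `<=` <<s preimages (eps_tuple eps i) >>.
Proof.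
apply: smallest_sub; first exact: smallest_sigma_algebra.
apply: (big_ind (fun G => G `<=` <<s preimages (eps_tuple eps i) >>)) => //.
- by move=> G G' GS GS'; rewrite subUset.
- move=> s _ _ [B mB <-].
  exact: (@sigma_eps_tuple_eps i _ measurableT B mB).
Qed.

Lemma strict_past_measurable i t : strict_past (fun t => eps i t) t `<=` measurable.
Proof.
apply: (subset_trans (@strict_past_sub i t)); apply: sigma_sub_measurable.
by apply: preimages_measurable; exact: measurable_eps_tuple.
Qed.

Lemma strict_past_setT i t : strict_past (fun t => eps i t) t setT.
Proof. exact: (@measurableT _ (g_sigma_algebraType _)). Qed.

Lemma past_measurable i t : past i t `<=` measurable.
Proof.
move=> _ [F [H [E [oF pH sE ->]]]]; apply: measurableI.
  exact: other_units_measurable oF.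
apply: measurableI; last exact: strict_past_measurable sE.
by apply: preimages_measurable pH; exact: measurable_X_tuple.
Qed.

Lemma past_setI i t : setI_closed (past i t).
Proof.
move=> _ _ [F [H [E [oF pH sE ->]]]] [F' [H' [E' [oF' pH' sE' ->]]]].
exists (F `&` F'), (H `&` H'), (E `&` E'); split.
- exact: other_units_setI.
- exact: preimages_setI.
- exact: (@measurableI _ (g_sigma_algebraType _)).
- by rewrite setIACA; congr (_ `&` _); rewrite setIACA.
Qed.

Lemma past_setT i t : past i t setT.
Proof.
exists setT, setT, setT; split; rewrite ?setIT//.
- exact: other_units_setT.
- exact: preimages_setT.
- exact: strict_past_setT.
Qed.

Lemma past_other_unit i t i' (h : Om -> R) : i' != i ->
  sigma_measurable (preimages (unit_data i')) h -> sigma_measurable (past i t) h.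
Proof.
move=> ii; apply: sigma_measurable_sub => A pA; apply: sub_gen_smallest.
exists A, setT, setT; split; rewrite ?setIT//.
- exact: other_units_preimages ii _ pA.
- exact: preimages_setT.
- exact: strict_past_setT.
Qed.

Lemma past_x i t s k : sigma_measurable (past i t) (x i s k).
Proof.
apply: sigma_measurable_sub (@sigma_X_tuple_x i s k) => A pA; apply: sub_gen_smallest.
exists setT, A, setT; split; rewrite ?setIT ?setTI//.
- exact: other_units_setT.
- exact: strict_past_setT.
Qed.

Lemma past_eps i (t s : 'I_T) : (s < t)%N -> sigma_measurable (past i t) (eps i s).
Proof.
move=> st _ B mB; rewrite setTI; apply: sub_gen_smallest.
exists setT, setT, (eps i s @^-1` B); split; rewrite ?setIT ?setTI//.
- exact: other_units_setT.
- exact: preimages_setT.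
apply: sub_gen_smallest; rewrite (bigD1 (Ordinal st))//=; left.
exists B => //; rewrite setTI; congr (eps i _ @^-1` B).
exact: val_inj.
Qed.

Lemma integrable_eps i t : P.-integrable setT (EFin \o eps i t).
Proof. by case: A1 => _ _ _ /(_ i t)[]. Qed.

(** On a set of the pi-system the three independence facts factor the integral
    of [eps i t] one after the other, and the martingale difference property
    makes the last factor vanish. *)
Lemma past_integral_eps i t A : past i t A ->
  (\int[P]_(w in A) (eps i t w)%:E = 0)%E.
Proof.
move=> [F [H [E [oF pH sE ->]]]].
have mX := @measurable_X_tuple i; have mE' := @measurable_eps_tuple i.
have mD := @measurable_unit_data i.
have mF := other_units_measurable oF.
have mH := preimages_measurable mX pH.
have mE := strict_past_measurable sE.
have iE : P.-integrable setT (EFin \o (fun w => \1_E w * eps i t w)).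
  apply: le_integrable (integrable_eps i t) => //.
    by apply/measurable_EFinP; apply: measurable_funM => //; exact: measurable_indic.
  move=> w _ /=; rewrite lee_fin normrM ler_piMl//.
  by rewrite indicE; case: (_ \in _); rewrite ?normr1 ?normr0.
have iHE : P.-integrable setT (EFin \o (fun w => \1_H w * (\1_E w * eps i t w))).
  apply: le_integrable iE => //.
    apply/measurable_EFinP; apply: measurable_funM; first exact: measurable_indic.
    by apply: measurable_funM => //; exact: measurable_indic.
  move=> w _ /=; rewrite lee_fin normrM ler_piMl//.
  by rewrite indicE; case: (_ \in _); rewrite ?normr1 ?normr0.
have sig (G : set_system Om) B : <<s G >> B -> sigma_measurable G (\1_B : Om -> R).
  by move=> GB; exact: (@measurable_indic _ (g_sigma_algebraType G)).
have sE1 : sigma_measurable (preimages (eps_tuple eps i)) (fun w => \1_E w * eps i t w).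
  apply: measurable_funM; first by apply: sig; exact: strict_past_sub sE.
  exact: sigma_eps_tuple_eps.
have epsD : preimages (eps_tuple eps i) `<=` preimages (unit_data i).
  move=> _ [B mB ->]; exists (setT `*` B); first exact: measurableX.
  by apply/seteqP; split => w /=; [|case].
have XD : preimages (X_tuple x i) `<=` preimages (unit_data i).
  move=> _ [B mB ->]; exists (B `*` setT); first exact: measurableX.
  by apply/seteqP; split => w /=; [|case].
have sHE : sigma_measurable (preimages (unit_data i))
    (fun w => \1_H w * (\1_E w * eps i t w)).
  apply: measurable_funM.
    by apply: sig; apply: sub_gen_smallest; exact: XD.
  by apply: sigma_measurable_sub sE1; exact: subset_trans epsD (@sub_gen_smallest _ _ _).
rewrite integral_mkcond.
rewrite (eq_integral ((fun w => (\1_H w * (\1_E w * eps i t w))%:E) \_ F)); last first.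
  move=> w _; rewrite !patchE !in_setI !indicE.
  by case: (w \in F); case: (w \in H); case: (w \in E); rewrite /= ?mul1r ?mul0r.
rewrite -integral_mkcond.
rewrite (integral_independent_event (G := preimages (unit_data i)))//; last 4 first.
- exact: preimages_measurable.
- exact: preimages_setI.
- exact: preimages_setT.
- exact: independent_other_units.
rewrite (eq_integral ((fun w => (\1_E w * eps i t w)%:E) \_ H)); last first.
  move=> w _; rewrite patchE indicE.
  by case: (w \in H); rewrite ?mul1r ?mul0r.
rewrite -integral_mkcond.
rewrite (integral_independent_event (G := preimages (eps_tuple eps i)))//; last 4 first.
- exact: preimages_measurable.
- exact: preimages_setI.
- exact: preimages_setT.
- move=> _ [B mB ->]; case: pH => B' mB' ->.
  by case: A1 => _ _ /(_ i) ind _; exact: ind.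
rewrite (eq_integral ((fun w => (eps i t w)%:E) \_ E)); last first.
  move=> w _; rewrite patchE indicE.
  by case: (w \in E); rewrite ?mul1r ?mul0r.
rewrite -integral_mkcond.
have -> : (\int[P]_(w in E) (eps i t w)%:E = 0)%E.
  by case: A1 => _ _ _ /(_ i t)[_ _ _ /(_ E sE) ->]; rewrite integral0.
by rewrite !mule0.
Qed.

Lemma past_orthogonal i t (h : Om -> R) : sigma_measurable (past i t) h ->
  all_moments P h -> all_moments P (eps i t) ->
  Rintegral P setT (fun w => h w * eps i t w) = 0.
Proof.
move=> mh ah ae; rewrite /Rintegral.
rewrite (@orthogonal_measurable _ _ _ P (past i t) (eps i t) h)//.
- exact: past_measurable.
- exact: past_setI.
- exact: past_setT.
- exact: integrable_eps.
- exact: past_integral_eps.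
- by apply: all_moments_integrable; exact: all_momentsM.
Qed.

Lemma other_units_orthogonal i (h Y : Om -> R) :
  sigma_measurable (other_units i) h -> sigma_measurable (preimages (unit_data i)) Y ->
  all_moments P h -> all_moments P Y -> Rintegral P setT Y = 0 ->
  Rintegral P setT (fun w => h w * Y w) = 0.
Proof.
move=> mh mY ah aY Y0; rewrite /Rintegral.
rewrite (@orthogonal_measurable _ _ _ P (other_units i) Y h)//.
- exact: other_units_measurable.
- exact: other_units_setI.
- exact: other_units_setT.
- exact: all_moments_integrable.
- move=> F oF; have mF := other_units_measurable oF.
  rewrite (integral_independent_event (G := preimages (unit_data i)))//.
  + by rewrite mean_EFin// Y0 mule0.
  + by apply: preimages_measurable; exact: measurable_unit_data.
  + exact: preimages_setI.
  + exact: preimages_setT.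
  + exact: independent_other_units.
  + exact: all_moments_integrable.
- by apply: all_moments_integrable; exact: all_momentsM.
Qed.

End PanelOrthogonality.

(** * Tail bounds for the panel *)

Section PanelTails.
Context {d : measure_display} {Om : measurableType d} {R : realType}.
Context {P : probability Om R} {N T p : nat}.
Variables (x : 'I_N -> 'I_T -> 'I_p -> {RV P >-> R}).
Variables (eps : 'I_N -> 'I_T -> {RV P >-> R}).
Variables (C K : R).
Hypotheses (C0 : 0 < C) (K0 : 0 < K).
Hypothesis A1 : assumption_A1 x eps.
Hypothesis A2b : assumption_A2b C K x eps.

Local Notation E X := (Rintegral P setT X).

(** The tail bounds are assumed for the first unit only; identical distribution
    carries them over to the others. *)
Lemma unit_data_law i i' (B : set (T.-tuple (p.-tuple R) * T.-tuple R)%type) :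
  measurable B -> P (unit_data x eps i @^-1` B) = P (unit_data x eps i' @^-1` B).
Proof. by move=> mB; case: A1 => _ /(_ i i' B mB). Qed.

Lemma first_unit (i : 'I_N) : {i0 : 'I_N | i0 = 0%N :> nat}.
Proof. by exists (Ordinal (leq_ltn_trans (leq0n i) (ltn_ord i))). Qed.

Lemma subgaussian_x i t k : subgaussian_tail C K P (x i t k).
Proof.
split=> // u u0; have [i0 i00] := first_unit i.
pose g (v : (T.-tuple (p.-tuple R) * T.-tuple R)%type) := tnth (tnth v.1 t) k.
have mg : measurable_fun setT g.
  exact: (measurableT_comp (measurable_tnth k)
    (measurableT_comp (measurable_tnth t) measurable_fst)).
have pre j : [set w | u <= `|x j t k w|] =
    unit_data x eps j @^-1` [set v | u <= `|g v|].
  by apply/seteqP; split => w; rewrite /g /= !tnth_mktuple.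
rewrite pre (unit_data_law i i0); last exact: measurable_ge_norm.
by rewrite -pre; have [/(_ k)] := A2b i00 t u0.
Qed.

Lemma subgaussian_eps i t : subgaussian_tail C K P (eps i t).
Proof.
split=> // u u0; have [i0 i00] := first_unit i.
pose g (v : (T.-tuple (p.-tuple R) * T.-tuple R)%type) := tnth v.2 t.
have mg : measurable_fun setT g.
  exact: (measurableT_comp (measurable_tnth t) measurable_snd).
have pre j : [set w | u <= `|eps j t w|] =
    unit_data x eps j @^-1` [set v | u <= `|g v|].
  by apply/seteqP; split => w; rewrite /g /= !tnth_mktuple.
rewrite pre (unit_data_law i i0); last exact: measurable_ge_norm.
by rewrite -pre; have [_] := A2b i00 t u0.
Qed.

Definition panel_scale : R := 16 * (subgaussian_scale C K + 1).
Definition panel_rate : R := tail_rate panel_scale.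

Let a0 : 0 <= subgaussian_scale C K.
Proof. exact: ltW (subgaussian_scale_gt0 C0 K0). Qed.

Lemma panel_scale_gt0 : 0 < panel_scale.
Proof. by rewrite mulr_gt0// ltr_wpDl. Qed.

Let am_x i t k : all_moments P (x i t k).
Proof. exact: subgaussian_all_moments (subgaussian_x i t k). Qed.

Let am_eps i t : all_moments P (eps i t).
Proof. exact: subgaussian_all_moments (subgaussian_eps i t). Qed.

Lemma subexponential_score i t k :
  subexponential P panel_scale (fun w => x i t k w * eps i t w).
Proof.
apply: (@le_subexponential _ _ _ _ (4 * subgaussian_scale C K)).
- by rewrite mulr_ge0.
- by rewrite /panel_scale; move: a0; lra.
apply: subexponentialM => // m m0.
- exact: subgaussian_moment_le (subgaussian_x i t k) _ m0.
- exact: subgaussian_moment_le (subgaussian_eps i t) _ m0.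
Qed.

Lemma subexponential_eps i t : subexponential P panel_scale (eps i t).
Proof.
apply: (@le_subexponential _ _ _ _ (subgaussian_scale C K + 1)).
- by rewrite addr_ge0.
- by rewrite /panel_scale; move: a0; lra.
apply: subexponential_of_subgaussian => // m m0.
exact: subgaussian_moment_le (subgaussian_eps i t) _ m0.
Qed.

Definition gram_mean i t j k : R := E (fun w => x i t j w * x i t k w).

Lemma subexponential_gram i t j k :
  subexponential P panel_scale (fun w => x i t j w * x i t k w - gram_mean i t j k).
Proof.
apply: (@le_subexponential _ _ _ _ (4 * (4 * subgaussian_scale C K))).
- by rewrite mulr_ge0// mulr_ge0.
- by rewrite /panel_scale; move: a0; lra.
apply: subexponential_center; first by rewrite mulr_ge0.
apply: subexponentialM => // m m0.
- exact: subgaussian_moment_le (subgaussian_x i t j) _ m0.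
- exact: subgaussian_moment_le (subgaussian_x i t k) _ m0.
Qed.

Lemma sigma_measurable_sum_cond (G : set_system Om) (I : finType) (Q : pred I)
    (D : I -> Om -> R) : (forall i, Q i -> sigma_measurable G (D i)) ->
  sigma_measurable G (fun w => \sum_(i | Q i) D i w).
Proof.
move=> mD; rewrite /sigma_measurable; under eq_fun do rewrite big_mkcond.
apply: measurable_sum => i; have [Qi|Qi] := boolP (Q i); first exact: mD.
exact: measurable_cst.
Qed.

Definition lex_key (u : 'I_N * 'I_T) : nat := (u.1 * T + u.2)%N.

Lemma lex_key_inj : injective lex_key.
Proof.
move=> [i t] [j s] /= h; have ht := ltn_ord t; have hs := ltn_ord s.
have T0 : (0 < T)%N by exact: leq_ltn_trans (leq0n t) ht.
have ij : i = j :> nat.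
  have h' : (i * T + t = j * T + s)%N by exact: h.
  have : ((i * T + t) %/ T = (j * T + s) %/ T)%N by rewrite h'.
  rewrite (divnMDl i t T0) (divnMDl j s T0).
  by rewrite (divn_small ht) (divn_small hs) !addn0.
have ts : t = s :> nat by move: h; rewrite /lex_key /= ij => /addnI.
by congr pair; exact: val_inj.
Qed.

Lemma lex_key_lt u v : (lex_key u < lex_key v)%N -> u.1 = v.1 -> (u.2 < v.2)%N.
Proof. by move=> h e; move: h; rewrite /lex_key e ltn_add2l. Qed.

(** The entry of [X' eps] for the regressor [k] is one martingale of length
    [N T]: going through the units one after the other keeps the power 3 of the
    logarithms, which treating the blocks separately would raise to 4. *)
Lemma score_tail (k : 'I_p) (L r : R) : (0 < N)%N -> (0 < T)%N ->
  0 <= L -> 0 <= r -> r ^+ 2 = (N * T)%:R * L ^+ 3 ->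
  (P [set w | (r < `|\sum_i \sum_t x i t k w * eps i t w|)%R] <=
    (expR (1 - panel_rate * L))%:E)%E.
Proof.
move=> N0 T0 L0 r0 r2.
pose D (u : 'I_N * 'I_T) w := x u.1 u.2 k w * eps u.1 u.2 w.
have -> : [set w | r < `|\sum_i \sum_t x i t k w * eps i t w|] =
    [set w | r < `|\sum_u D u w|].
  by apply/seteqP; split => w /=; rewrite pair_big.
apply: (orthogonal_sum_tail lex_key_inj) => //.
- by rewrite card_prod !card_ord muln_gt0 N0.
- exact: panel_scale_gt0.
- by rewrite card_prod !card_ord.
- by move=> u; exact: subexponential_score.
move=> m [i t] m0.
under eq_Rintegral do rewrite /D mulrA.
have mS : sigma_measurable (past x eps i t)
    (fun w => \sum_(v | (lex_key v < lex_key (i, t))%N) D v w).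
  apply: sigma_measurable_sum_cond => -[i' t'] lt.
  have [ii|ii] := eqVneq i' i.
    subst i'; have tt := lex_key_lt lt erefl.
    by apply: measurable_funM; [exact: past_x|exact: past_eps].
  apply: (past_other_unit ii).
  by apply: measurable_funM; [exact: sigma_unit_data_x|exact: sigma_unit_data_eps].
apply: (past_orthogonal A1) => //=.
- apply: measurable_funM; last exact: past_x.
  exact: measurable_funX.
- apply: all_momentsM => //; apply: all_momentsX.
  by apply: all_moments_sum => v _; exact: all_momentsM.
Qed.

Lemma error_sum_tail (i : 'I_N) (L r : R) : (0 < T)%N ->
  0 <= L -> 0 <= r -> r ^+ 2 = T%:R * L ^+ 3 ->
  (P [set w | (r < `|\sum_t eps i t w|)%R] <=
    (expR (1 - panel_rate * L))%:E)%E.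
Proof.
move=> T0 L0 r0 r2.
apply: (@orthogonal_sum_tail _ _ _ P _ (@nat_of_ord T)) => //.
- exact: ord_inj.
- by rewrite card_ord.
- exact: panel_scale_gt0.
- by rewrite card_ord.
- by move=> t; exact: subexponential_eps.
move=> m t m0; apply: (past_orthogonal A1) => //.
- apply: measurable_funX; apply: sigma_measurable_sum_cond => s st.
  exact: past_eps.
- by apply: all_momentsX; exact: all_moments_sum.
Qed.

Lemma gram_tail t (j k : 'I_p) (L r : R) : (0 < N)%N ->
  0 <= L -> 0 <= r -> r ^+ 2 = N%:R * L ^+ 3 ->
  (P [set w | (r < `|\sum_i (x i t j w * x i t k w - gram_mean i t j k)|)%R] <=
    (expR (1 - panel_rate * L))%:E)%E.
Proof.
move=> N0 L0 r0 r2.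
have sD i : sigma_measurable (preimages (unit_data x eps i))
    (fun w => x i t j w * x i t k w - gram_mean i t j k).
  apply: measurable_funB; last exact: measurable_cst.
  by apply: measurable_funM; exact: sigma_unit_data_x.
have aD i : all_moments P (fun w => x i t j w * x i t k w - gram_mean i t j k).
  exact: subexponential_all_moments (subexponential_gram i t j k).
apply: (@orthogonal_sum_tail _ _ _ P _ (@nat_of_ord N)) => //.
- exact: ord_inj.
- by rewrite card_ord.
- exact: panel_scale_gt0.
- by rewrite card_ord.
- by move=> i; exact: subexponential_gram.
move=> m i m0; apply: (other_units_orthogonal A1 (i := i)) => //.
- apply: measurable_funX; apply: sigma_measurable_sum_cond => i' lt.
  apply: sigma_measurable_sub (sD i') => A pA; apply: sub_gen_smallest.
  by apply: other_units_preimages pA; rewrite neq_ltn lt.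
- by apply: all_momentsX; exact: all_moments_sum.
have aM : all_moments P (fun w => x i t j w * x i t k w) by exact: all_momentsM.
rewrite meanD//; last exact: all_moments_cst.
by rewrite [X in _ + X](mean_cst P) subrr.
Qed.

Lemma x_tail i t k (u : R) : 0 < u ->
  (P [set w | (u < `|x i t k w|)%R] <= (K * expR (- C * u ^+ 2))%:E)%E.
Proof.
move=> u0; have [mX /(_ u u0) h] := subgaussian_x i t k.
apply: (@le_trans _ _ (P [set w | (u <= `|x i t k w|)%R])).
  apply: le_measure; rewrite ?inE; [exact: measurable_gt_norm|
    exact: measurable_ge_norm|by move=> w /= /ltW].
apply: (le_trans h); rewrite lee_fin ler_wpM2r ?expR_ge0//.
by move: K0; lra.
Qed.

End PanelTails.

(** * The oracle inequality on a deterministic event *)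

Section Norms.
Context {R : realType} {n : nat}.
Implicit Types (v : 'cV[R]_n) (A : {set 'I_n}).

Lemma sqr_l2norm v : l2norm v ^+ 2 = \sum_j v j 0 ^+ 2.
Proof. by rewrite sqr_sqrtr// sumr_ge0// => j _; exact: sqr_ge0. Qed.

Lemma l2norm_ge0 v : 0 <= l2norm v.
Proof. exact: sqrtr_ge0. Qed.

Lemma l2norm_eq0 v : l2norm v = 0 -> v = 0.
Proof.
move=> v0; apply/colP => j; rewrite mxE.
have : \sum_j v j 0 ^+ 2 = 0 by rewrite -sqr_l2norm v0 expr0n.
move=> /eqP; rewrite psumr_eq0; last by move=> k _; exact: sqr_ge0.
by move=> /allP /(_ j); rewrite mem_index_enum sqrf_eq0 => /(_ isT)/eqP.
Qed.

Lemma entry_le_l2norm v j : `|v j 0| <= l2norm v.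
Proof.
rewrite -sqrtr_sqr ler_sqrt ?sumr_ge0// => [|k _]; last exact: sqr_ge0.
by rewrite (bigD1 j)//= lerDl sumr_ge0// => k _; exact: sqr_ge0.
Qed.

Lemma l2normZ c v : 0 <= c -> l2norm (c *: v) = c * l2norm v.
Proof.
move=> c0; rewrite /l2norm; under eq_bigr do rewrite mxE exprMn.
by rewrite -mulr_sumr sqrtrM ?sqr_ge0// sqrtr_sqr ger0_norm.
Qed.

Lemma l1norm_onZ c A v : 0 <= c -> l1norm_on A (c *: v) = c * l1norm_on A v.
Proof.
move=> c0; rewrite /l1norm_on mulr_sumr; apply: eq_bigr => j _.
by rewrite mxE normrM ger0_norm.
Qed.

Lemma l1norm_on_ge0 A v : 0 <= l1norm_on A v.
Proof. exact: sumr_ge0. Qed.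

Lemma l1normE A v : l1norm v = l1norm_on A v + l1norm_on (~: A)%SET v.
Proof.
rewrite /l1norm /l1norm_on (bigID (mem A))/=; congr (_ + _);
by apply: eq_bigl => j; rewrite !inE.
Qed.

Lemma l1norm_on_le A v : l1norm_on A v <= Num.sqrt #|A|%:R * l2norm v.
Proof.
have [A0|A0] := posnP #|A|.
  rewrite A0 sqrtr0 mul0r /l1norm_on big_pred0// => j.
  by have := card0_eq A0 j.
have Ap : 0 < #|A|%:R :> R by rewrite ltr0n.
rewrite -[leLHS]ger0_norm ?l1norm_on_ge0// -sqrtr_sqr /l2norm -sqrtrM//.
rewrite ler_sqrt; last by rewrite mulr_ge0// sumr_ge0// => j _; exact: sqr_ge0.
set S := l1norm_on A v; pose c := S / #|A|%:R.
have : 0 <= \sum_(j in A) (`|v j 0| - c) ^+ 2.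
  by apply: sumr_ge0 => j _; exact: sqr_ge0.
have -> : \sum_(j in A) (`|v j 0| - c) ^+ 2 =
    \sum_(j in A) v j 0 ^+ 2 - 2 * c * S + #|A|%:R * c ^+ 2.
  rewrite /S /l1norm_on mulr_sumr -sumrB -mulr_natl -sumr_const mulr_suml -big_split.
  apply: eq_bigr => j _ /=; rewrite sqrrB real_normK ?num_real//.
  by rewrite -mulr_natl; ring.
have -> : 2 * c * S = 2 * (#|A|%:R * c ^+ 2) by rewrite /c; field; rewrite gt_eqF.
have -> : S ^+ 2 = #|A|%:R * (#|A|%:R * c ^+ 2) by rewrite /c; field; rewrite gt_eqF.
rewrite ler_pM2l// => h; apply: (@le_trans _ _ (\sum_(j in A) v j 0 ^+ 2)).
  by lra.
rewrite [leRHS](bigID (mem A))/= lerDl sumr_ge0// => j _; exact: sqr_ge0.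
Qed.

End Norms.

Lemma l2norm_col_mx (R : realType) (m n : nat) (v : 'cV[R]_(m + n)) :
  l2norm v ^+ 2 = l2norm (usubmx v) ^+ 2 + l2norm (dsubmx v) ^+ 2.
Proof.
rewrite !sqr_l2norm big_split_ord/=; congr (_ + _);
by apply: eq_bigr => j _; rewrite mxE.
Qed.

Lemma l2norm_usubmx_le (R : realType) (m n : nat) (v : 'cV[R]_(m + n)) :
  l2norm (usubmx v) <= l2norm v.
Proof.
rewrite -(ler_pXn2r (n := 2))// ?nnegrE ?l2norm_ge0//.
by rewrite l2norm_col_mx lerDl sqr_ge0.
Qed.

Lemma l2norm_dsubmx_le (R : realType) (m n : nat) (v : 'cV[R]_(m + n)) :
  l2norm (dsubmx v) <= l2norm v.
Proof.
rewrite -(ler_pXn2r (n := 2))// ?nnegrE ?l2norm_ge0//.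
by rewrite l2norm_col_mx lerDr sqr_ge0.
Qed.

(** The pointwise inequality behind the cone condition: the l1-penalty at the
    truth exceeds the penalty at an estimate only through the support. *)
Lemma l1_decomposition (R : realType) (n : nat) (v vhat : 'cV[R]_n) :
  l1norm v - l1norm vhat + l1norm (vhat - v) <=
  2 * l1norm_on (support_set v) (vhat - v).
Proof.
rewrite /l1norm /l1norm_on -sumrB -big_split/= mulr_sumr.
rewrite [leRHS]big_mkcond [leLHS]big_mkcond/=; apply: ler_sum => j _.
rewrite !inE !mxE; have [->|v0] := eqVneq (v j 0) 0 => /=.
  by rewrite normr0 subr0; lra.
have := ler_normB (vhat j 0) (vhat j 0 - v j 0).
by rewrite subKr; lra.
Qed.

Section Oracle.
Context {R : realType} {N T p : nat}.
Variables (X : 'I_N -> 'M[R]_(T, p)) (e : 'I_N -> 'cV[R]_T).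
Variables (b bhat : 'cV[R]_p) (c chat : 'cV[R]_N).
Variables (lambda mu : R).
Hypotheses (lambda0 : 0 <= lambda) (mu0 : 0 <= mu).
Hypothesis lasso : is_panel_lasso lambda mu X
  (fun i => X i *m b + c i 0 *: const_mx 1 + e i) bhat chat.
Hypothesis score_X : forall k, `|\sum_i \sum_t X i t k * e i t 0| <= lambda / 2.
Hypothesis score_D : forall i, `|\sum_t e i t 0| <= mu / 2.

Let fit i t := (X i *m (bhat - b)) t 0 + (chat - c) i 0.

Let fit_error : \sum_i \sum_t e i t 0 * fit i t <=
  lambda / 2 * l1norm (bhat - b) + mu / 2 * l1norm (chat - c).
Proof.
have -> : \sum_i \sum_t e i t 0 * fit i t =
    \sum_k (bhat - b) k 0 * (\sum_i \sum_t X i t k * e i t 0) +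
    \sum_i (chat - c) i 0 * (\sum_t e i t 0).
  under [X in _ = X + _]eq_bigr do rewrite mulr_sumr.
  rewrite [X in _ = X + _]exchange_big -big_split/=; apply: eq_bigr => i _.
  under [X in _ = X + _]eq_bigr do rewrite mulr_sumr.
  rewrite [X in _ = X + _]exchange_big mulr_sumr -big_split/=; apply: eq_bigr => t _.
  rewrite /fit mulrDr [e i t 0 * (chat - c) i 0]mulrC; congr (_ + _).
  rewrite mxE mulr_sumr; apply: eq_bigr => k _; ring.
rewrite /l1norm /l1norm_on !mulr_sumr.
rewrite [in X in _ <= X + _]big_mkcond [in X in _ <= _ + X]big_mkcond /=.
apply: lerD; apply: ler_sum => j _; rewrite inE (le_trans (ler_norm _))//.
  by rewrite normrM mulrC ler_wpM2r.
by rewrite normrM mulrC ler_wpM2r.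
Qed.

Lemma lasso_basic_inequality :
  \sum_i \sum_t fit i t ^+ 2 + lambda * l1norm (bhat - b) + mu * l1norm (chat - c)
  <= 4 * lambda * l1norm_on (support_set b) (bhat - b) +
     4 * mu * l1norm_on (support_set c) (chat - c).
Proof.
have := lasso b c; rewrite /lasso_objective.
have -> : \sum_i l2norm (X i *m b + c i 0 *: const_mx 1 + e i -
    (X i *m b + c i 0 *: const_mx 1)) ^+ 2 = \sum_i \sum_t e i t 0 ^+ 2.
  apply: eq_bigr => i _; rewrite sqr_l2norm; apply: eq_bigr => t _.
  by rewrite addrC addKr.
have -> : \sum_i l2norm (X i *m b + c i 0 *: const_mx 1 + e i -
    (X i *m bhat + chat i 0 *: const_mx 1)) ^+ 2 =
    \sum_i \sum_t e i t 0 ^+ 2 - 2 * (\sum_i \sum_t e i t 0 * fit i t) +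
    \sum_i \sum_t fit i t ^+ 2.
  rewrite !mulr_sumr -sumrB -big_split/=; apply: eq_bigr => i _.
  rewrite sqr_l2norm mulr_sumr -sumrB -big_split/=; apply: eq_bigr => t _.
  rewrite /fit mulmxBr !mxE; ring.
have := fit_error; have h1 := l1_decomposition b bhat.
have h2 := l1_decomposition c chat.
have := ler_wpM2l lambda0 h1; have := ler_wpM2l mu0 h2.
by rewrite !mulrDr !mulrN; lra.
Qed.

End Oracle.

Section GramPerturbation.
Context {R : realType} {N T p : nat}.
Variables (X : 'I_N -> 'M[R]_(T, p)) (G : 'M[R]_p) (eta1 u : R).
Hypotheses (N0 : (0 < N)%N) (T0 : (0 < T)%N).
Hypothesis gram_X : forall k l,
  `|((N * T)%:R)^-1 * (\sum_i \sum_t X i t k * X i t l) - G k l| <= eta1.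
Hypothesis gram_D : forall i k, `|\sum_t X i t k| <= T%:R * u.

Lemma Gamma_quadratic (v : 'cV[R]_p) (z : 'cV[R]_N) :
  ((col_mx v z)^T *m block_mx G 0 0 1%:M *m col_mx v z) 0 0 =
  \sum_k \sum_l v k 0 * v l 0 * G k l + \sum_i z i 0 ^+ 2.
Proof.
rewrite tr_col_mx mul_row_block mul_row_col !mulmx0 add0r addr0 mulmx1 mxE.
congr (_ + _); rewrite mxE.
  rewrite exchange_big; apply: eq_bigr => l _; rewrite mxE mulr_suml.
  by apply: eq_bigr => k _; rewrite mxE; ring.
by apply: eq_bigr => i _; rewrite mxE expr2.
Qed.

Let NT0 : 0 < (N * T)%:R :> R. Proof. by rewrite ltr0n muln_gt0 N0. Qed.
Let Np : 0 < N%:R :> R. Proof. by rewrite ltr0n. Qed.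
Let Tp : 0 < T%:R :> R. Proof. by rewrite ltr0n. Qed.

(** The empirical Gram matrix of [(X, D)], rescaled, differs from [Gamma] by
    [eta1] in the block of [X] and by [u / sqrt N] in the off-diagonal block;
    the block of [D] is exactly the identity. *)
Lemma gram_lower_bound (v : 'cV[R]_p) (z : 'cV[R]_N) :
  ((col_mx v z)^T *m block_mx G 0 0 1%:M *m col_mx v z) 0 0
    - eta1 * l1norm v ^+ 2 - 2 * (u / Num.sqrt N%:R) * (l1norm v * l1norm z)
  <= \sum_i \sum_t ((X i *m v) t 0 / Num.sqrt (N * T)%:R
                    + z i 0 / Num.sqrt T%:R) ^+ 2.
Proof.
rewrite Gamma_quadratic.
set a := (Num.sqrt (N * T)%:R)^-1; set b := (Num.sqrt T%:R)^-1.
have a2 : a ^+ 2 = ((N * T)%:R)^-1 by rewrite exprVn sqr_sqrtr// ltW.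
have b2 : b ^+ 2 * T%:R = 1 by rewrite exprVn sqr_sqrtr ?ltW// mulVf ?gt_eqF.
have abT : a * b * T%:R = (Num.sqrt N%:R)^-1.
  have sT2 : T%:R = Num.sqrt T%:R ^+ 2 :> R by rewrite sqr_sqrtr.
  rewrite /a /b natrM sqrtrM// [X in _ * X]sT2.
  by field; rewrite !gt_eqF// sqrtr_gt0.
have a0 : 0 <= a by rewrite invr_ge0 sqrtr_ge0.
have b0 : 0 <= b by rewrite invr_ge0 sqrtr_ge0.
have -> : \sum_i \sum_t ((X i *m v) t 0 * a + z i 0 * b) ^+ 2 =
    \sum_k \sum_l v k 0 * v l 0 * (((N * T)%:R)^-1 * (\sum_i \sum_t X i t k * X i t l))
    + 2 * (a * b) * (\sum_i \sum_k z i 0 * v k 0 * \sum_t X i t k)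
    + \sum_i z i 0 ^+ 2.
  have e1 : \sum_k \sum_l v k 0 * v l 0 *
      (((N * T)%:R)^-1 * (\sum_i \sum_t X i t k * X i t l)) =
      \sum_i \sum_t a ^+ 2 * (X i *m v) t 0 ^+ 2.
    have -> : \sum_i \sum_t a ^+ 2 * (X i *m v) t 0 ^+ 2 =
        \sum_i \sum_t \sum_k \sum_l
          v k 0 * v l 0 * (((N * T)%:R)^-1 * (X i t k * X i t l)).
      apply: eq_bigr => i _; apply: eq_bigr => t _.
      rewrite a2 expr2 mxE mulr_suml mulr_sumr; apply: eq_bigr => k _.
      by rewrite !mulr_sumr; apply: eq_bigr => l _; ring.
    under [RHS]eq_bigr do rewrite exchange_big /=.
    rewrite [RHS]exchange_big; apply: eq_bigr => k _ /=.
    under [RHS]eq_bigr do rewrite exchange_big /=.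
    rewrite [RHS]exchange_big; apply: eq_bigr => l _ /=.
    rewrite !mulr_sumr; apply: eq_bigr => i _.
    by rewrite !mulr_sumr.
  have e2 : 2 * (a * b) * (\sum_i \sum_k z i 0 * v k 0 * \sum_t X i t k) =
      \sum_i \sum_t 2 * (a * b) * (z i 0 * (X i *m v) t 0).
    rewrite mulr_sumr; apply: eq_bigr => i _.
    rewrite -mulr_sumr; congr (_ * _).
    under [RHS]eq_bigr do rewrite mxE mulr_sumr.
    rewrite [RHS]exchange_big; apply: eq_bigr => k _ /=.
    by rewrite mulr_sumr; apply: eq_bigr => t _; ring.
  have e3 : \sum_i z i 0 ^+ 2 = \sum_i \sum_(t < T) b ^+ 2 * z i 0 ^+ 2.
    apply: eq_bigr => i _; rewrite sumr_const card_ord -[RHS]mulr_natl.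
    by rewrite mulrA [_ * b ^+ 2]mulrC b2 mul1r.
  rewrite e1 e2 [in RHS]e3 -!big_split/=; apply: eq_bigr => i _.
  by rewrite -!big_split/=; apply: eq_bigr => t _; ring.
have h1 : \sum_k \sum_l v k 0 * v l 0 * G k l - eta1 * l1norm v ^+ 2 <=
   \sum_k \sum_l v k 0 * v l 0 * (((N * T)%:R)^-1 * (\sum_i \sum_t X i t k * X i t l)).
  have -> : l1norm v ^+ 2 = \sum_k \sum_l `|v k 0| * `|v l 0|.
    rewrite /l1norm /l1norm_on [in LHS]big_mkcond /=.
    under eq_bigr do rewrite inE.
    by rewrite expr2 mulr_suml; apply: eq_bigr => k _; rewrite mulr_sumr.
  rewrite mulr_sumr -sumrB; apply: ler_sum => k _.
  rewrite mulr_sumr -sumrB; apply: ler_sum => l _.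
  rewrite lerBlDr -lerBlDl -mulrBr (le_trans (ler_norm _))// normrM distrC.
  by rewrite normrM mulrC ler_wpM2r.
have h2 : - (T%:R * u * (l1norm v * l1norm z)) <=
    \sum_i \sum_k z i 0 * v k 0 * \sum_t X i t k.
  have -> : l1norm v * l1norm z = \sum_i \sum_k `|z i 0| * `|v k 0|.
    rewrite /l1norm /l1norm_on [X in X * _]big_mkcond [X in _ * X]big_mkcond /=.
    under eq_bigr do rewrite inE.
    under [X in _ * X]eq_bigr do rewrite inE.
    by rewrite mulrC mulr_suml; apply: eq_bigr => i _; rewrite mulr_sumr.
  rewrite mulr_sumr -sumrN; apply: ler_sum => i _.
  rewrite mulr_sumr -sumrN; apply: ler_sum => k _.
  rewrite lerNl (le_trans (ler_norm _))// normrN !normrM mulrC ler_wpM2r//.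
have h3 : 2 * (u / Num.sqrt N%:R) * (l1norm v * l1norm z) =
    2 * (a * b) * (T%:R * u * (l1norm v * l1norm z)).
  by rewrite -abT; ring.
have ab0 : 0 <= 2 * (a * b) by rewrite !mulr_ge0.
have := ler_wpM2l ab0 h2; rewrite mulrN -h3; lra.
Qed.

End GramPerturbation.

Section OracleInequality.
Context {R : realType} {N T p : nat}.
Variables (X : 'I_N -> 'M[R]_(T, p)) (e : 'I_N -> 'cV[R]_T).
Variables (b bhat : 'cV[R]_p) (c chat : 'cV[R]_N) (G : 'M[R]_p).
Variables (lambda mu eta1 u kappa : R).
Hypotheses (N0 : (0 < N)%N) (T0 : (0 < T)%N) (kappa0 : 0 < kappa).
Hypotheses (lambda0 : 0 < lambda) (mu0 : 0 < mu).
Hypotheses (eta0 : 0 <= eta1) (u0 : 0 <= u).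
Hypothesis lasso : is_panel_lasso lambda mu X
  (fun i => X i *m b + c i 0 *: const_mx 1 + e i) bhat chat.
Hypothesis score_X : forall k, `|\sum_i \sum_t X i t k * e i t 0| <= lambda / 2.
Hypothesis score_D : forall i, `|\sum_t e i t 0| <= mu / 2.
Hypothesis gram_X : forall k l,
  `|((N * T)%:R)^-1 * (\sum_i \sum_t X i t k * X i t l) - G k l| <= eta1.
Hypothesis gram_D : forall i k, `|\sum_t X i t k| <= T%:R * u.
Hypothesis restricted_eigenvalue : forall delta : 'cV[R]_(p + N),
  cone_condition (T := T) lambda mu (support_set b) (support_set c) delta ->
  kappa * l2norm delta ^+ 2 <= (delta^T *m block_mx G 0 0 1%:M *m delta) 0 0.

Let lam := lambda / Num.sqrt (N * T)%:R.
Let m := mu / Num.sqrt T%:R.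
Let M := lam * Num.sqrt #|support_set b|%:R + m * Num.sqrt #|support_set c|%:R.

Hypothesis perturbation_small :
  16 * M ^+ 2 * (eta1 / lam ^+ 2 + 2 * (u / Num.sqrt N%:R) / (lam * m)) <= kappa / 2.

Let sNT : 0 < Num.sqrt (N * T)%:R :> R.
Proof. by rewrite sqrtr_gt0 ltr0n muln_gt0 N0. Qed.
Let sT : 0 < Num.sqrt T%:R :> R. Proof. by rewrite sqrtr_gt0 ltr0n. Qed.
Let lam0 : 0 < lam. Proof. exact: divr_gt0. Qed.
Let m0 : 0 < m. Proof. exact: divr_gt0. Qed.

Let v := Num.sqrt (N * T)%:R *: (bhat - b).
Let z := Num.sqrt T%:R *: (chat - c).

(** On the cone the l1-norms are dominated by [4 M] times the l2-norm, so the
    perturbation of the Gram matrix costs at most half of [kappa]. *)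
Lemma oracle_inequality : l2norm (col_mx v z) <= 8 * M / kappa.
Proof.
set D := l2norm (col_mx v z).
have D0 : 0 <= D by exact: l2norm_ge0.
have vJ A : lambda * l1norm_on A (bhat - b) = lam * l1norm_on A v.
  by rewrite l1norm_onZ ?ltW// /lam mulrA divfK// gt_eqF.
have zJ A : mu * l1norm_on A (chat - c) = m * l1norm_on A z.
  by rewrite l1norm_onZ ?ltW// /m mulrA divfK// gt_eqF.
have := lasso_basic_inequality (ltW lambda0) (ltW mu0) lasso score_X score_D.
have -> : \sum_i \sum_t ((X i *m (bhat - b)) t 0 + (chat - c) i 0) ^+ 2 =
    \sum_i \sum_t ((X i *m v) t 0 / Num.sqrt (N * T)%:R + z i 0 / Num.sqrt T%:R) ^+ 2.
  apply: eq_bigr => i _; apply: eq_bigr => t _; congr (_ ^+ 2).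
  rewrite /v /z -scalemxAr [in RHS]mxE [X in _ = _ + X / _]mxE.
  by rewrite mulrAC divff ?gt_eqF// mul1r mulrAC divff ?gt_eqF// mul1r.
set Q := \sum_i \sum_t _.
have Q0 : 0 <= Q by apply: sumr_ge0 => i _; apply: sumr_ge0 => t _; exact: sqr_ge0.
have vJ1 : lambda * l1norm (bhat - b) = lam * l1norm v by exact: vJ.
have zJ1 : mu * l1norm (chat - c) = m * l1norm z by exact: zJ.
rewrite vJ1 zJ1 -2!mulrA !vJ !zJ => basic.
have vs : lam * l1norm_on (support_set b) v <=
    lam * (Num.sqrt #|support_set b|%:R * D).
  rewrite ler_pM2l// (le_trans (l1norm_on_le _ _))// ler_wpM2l ?sqrtr_ge0//.
  by have := l2norm_usubmx_le (col_mx v z); rewrite col_mxKu.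
have zs : m * l1norm_on (support_set c) z <=
    m * (Num.sqrt #|support_set c|%:R * D).
  rewrite ler_pM2l// (le_trans (l1norm_on_le _ _))// ler_wpM2l ?sqrtr_ge0//.
  by have := l2norm_dsubmx_le (col_mx v z); rewrite col_mxKd.
have MD : M * D = lam * (Num.sqrt #|support_set b|%:R * D) +
    m * (Num.sqrt #|support_set c|%:R * D) by rewrite /M; ring.
have cone : cone_condition (T := T) lambda mu (support_set b) (support_set c) (col_mx v z).
  rewrite /cone_condition col_mxKu col_mxKd -/lam -/m.
  move: basic; rewrite (l1normE (support_set b) v) (l1normE (support_set c) z).
  by rewrite !mulrDr -!mulrA; lra.
have {cone} RE := restricted_eigenvalue cone.
have GL := gram_lower_bound N0 T0 gram_X gram_D v z.
have L1 : lam * l1norm v + m * l1norm z <= 4 * (M * D) by lra.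
have v1 : 0 <= l1norm v by exact: l1norm_on_ge0.
have z1 : 0 <= l1norm z by exact: l1norm_on_ge0.
have v4 : l1norm v <= 4 * (M * D) / lam.
  rewrite ler_pdivlMr// mulrC; apply: le_trans L1.
  by rewrite lerDl mulr_ge0// ltW.
have z4 : l1norm z <= 4 * (M * D) / m.
  rewrite ler_pdivlMr// mulrC; apply: le_trans L1.
  by rewrite lerDr mulr_ge0// ltW.
have M0 : 0 <= M by rewrite addr_ge0// mulr_ge0 ?sqrtr_ge0// ltW.
have MD0 : 0 <= 4 * (M * D) by rewrite !mulr_ge0.
have n2 : 0 <= u / Num.sqrt N%:R by rewrite divr_ge0// sqrtr_ge0.
have pert : eta1 * l1norm v ^+ 2 + 2 * (u / Num.sqrt N%:R) * (l1norm v * l1norm z) <=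
    kappa / 2 * D ^+ 2.
  apply: (@le_trans _ _ (eta1 * (4 * (M * D) / lam) ^+ 2 +
      2 * (u / Num.sqrt N%:R) * (4 * (M * D) / lam * (4 * (M * D) / m)))).
    apply: lerD; first by rewrite ler_wpM2l// lerXn2r// nnegrE (le_trans v1).
    by rewrite ler_wpM2l ?mulr_ge0//; apply: ler_pM.
  rewrite [leLHS](_ : _ = 16 * M ^+ 2 * (eta1 / lam ^+ 2 +
      2 * (u / Num.sqrt N%:R) / (lam * m)) * D ^+ 2).
    by rewrite ler_wpM2r ?sqr_ge0.
  by field; rewrite !gt_eqF// sqrtr_gt0 ltr0n.
have half : kappa / 2 * D ^+ 2 <= 4 * M * D.
  have lv : 0 <= lam * l1norm v by rewrite mulr_ge0// ltW.
  have mz : 0 <= m * l1norm z by rewrite mulr_ge0// ltW.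
  move: RE GL pert basic; rewrite -/D -/Q; lra.
have [->|Dn0] := eqVneq D 0; first by rewrite divr_ge0 ?mulr_ge0// ltW.
have Dp : 0 < D by rewrite lt_neqAle eq_sym Dn0.
rewrite ler_pdivlMr// -(ler_pM2r Dp); move: half; rewrite expr2; lra.
Qed.

Lemma oracle_beta : l2norm (bhat - b) <= 8 * M / kappa / Num.sqrt (N * T)%:R.
Proof.
rewrite ler_pdivlMr// mulrC; apply: le_trans oracle_inequality.
have := l2norm_usubmx_le (col_mx v z).
by rewrite col_mxKu /v l2normZ// ltW.
Qed.

Lemma oracle_c : l2norm (chat - c) <= 8 * M / kappa / Num.sqrt T%:R.
Proof.
rewrite ler_pdivlMr// mulrC; apply: le_trans oracle_inequality.
have := l2norm_dsubmx_le (col_mx v z).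
by rewrite col_mxKd /z l2normZ// ltW.
Qed.

End OracleInequality.

(** * The good event of a panel of fixed size *)

Section UnionBound.
Context {d : measure_display} {Om : measurableType d} {R : realType}.
Variable P : probability Om R.

Lemma union_bound (I : finType) (A : I -> set Om) (q : R) : 0 <= q ->
  (forall i, measurable (A i)) -> (forall i, (P (A i) <= q%:E)%E) ->
  measurable [set w | exists i, A i w] /\
  (P [set w | exists i, A i w] <= (#|I|%:R * q)%:E)%E.
Proof.
move=> q0 mA PA.
suff h (s : seq I) : measurable [set w | exists2 i, i \in s & A i w] /\
    (P [set w | exists2 i, i \in s & A i w] <= ((size s)%:R * q)%:E)%E.
  have := h (enum I); rewrite -cardE.
  rewrite (_ : [set w | exists2 i, _ & _] = [set w | exists i, A i w])//.
  by apply/seteqP; split => w [i]; [exists i|move=> Ai; exists i; rewrite ?mem_enum].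
elim: s => [|i s [ms Ps]].
  rewrite (_ : [set w | exists2 i, _ & _] = set0); last by apply/seteqP; split => w [].
  by rewrite measure0 mul0r.
have -> : [set w | exists2 j, j \in i :: s & A j w] =
    A i `|` [set w | exists2 j, j \in s & A j w].
  apply/seteqP; split => w.
    by move=> [j]; rewrite inE => /predU1P[->|js] Aj; [left|right; exists j].
  by move=> [Ai|[j js Aj]]; [exists i; rewrite ?mem_head|exists j; rewrite // inE js orbT].
split; first exact: measurableU.
apply: (le_trans (measureU2 _ _ _)) => //.
by rewrite /= -natr1 mulrDl mul1r addrC EFinD leeD.
Qed.

End UnionBound.

Section PanelEvent.
Context {d : measure_display} {Om : measurableType d} {R : realType}.
Context {P : probability Om R} {N T p : nat}.
Variables (x : 'I_N -> 'I_T -> 'I_p -> {RV P >-> R}).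
Variables (eps : 'I_N -> 'I_T -> {RV P >-> R}).
Variables (C K : R).
Hypotheses (C0 : 0 < C) (K0 : 0 < K) (N0 : (0 < N)%N) (T0 : (0 < T)%N).
Hypothesis A1 : assumption_A1 x eps.
Hypothesis A2b : assumption_A2b C K x eps.

Lemma kappa2_le (lambda mu : R) (s1 s2 : nat) (R1 : {set 'I_p}) (R2 : {set 'I_N})
    (delta : 'cV[R]_(p + N)) :
  0 < kappa2 x lambda mu s1 s2 -> (#|R1| <= s1)%N -> (#|R2| <= s2)%N ->
  cone_condition (T := T) lambda mu R1 R2 delta ->
  kappa2 x lambda mu s1 s2 * l2norm delta ^+ 2 <= (delta^T *m Gamma x *m delta) 0 0.
Proof.
move=> k0 R1s R2s cone.
have [->|delta0] := eqVneq delta 0.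
  rewrite mulmx0 mxE sqr_l2norm big1 ?mulr0// => j _.
  by rewrite mxE expr0n.
have D0 : 0 < l2norm delta ^+ 2.
  rewrite exprn_gt0// lt_neqAle l2norm_ge0 andbT eq_sym.
  by apply: contra_neq delta0 => /l2norm_eq0.
rewrite -ler_pdivlMr//; move: k0; rewrite /kappa2; set Q := [set q | _] => k0.
(* The infimum of a set without one is 0 by convention. *)
have hQ : has_inf Q by apply: contrapT => /inf_out Q0; move: k0; rewrite Q0 ltxx.
apply: ge_inf; first by case: hQ.
by exists R1, R2, delta.
Qed.

Lemma expected_gramE k l : expected_gram x k l =
  ((N * T)%:R)^-1 * \sum_i \sum_t gram_mean x i t k l.
Proof.
have am i t : all_moments P (fun w => x i t k w * x i t l w).
  by apply: all_momentsM; apply: (subgaussian_all_moments C0 K0);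
    exact: (subgaussian_x A1 A2b).
rewrite mxE unlock.
rewrite [LHS](_ : _ = Rintegral P setT (fun w => ((N * T)%:R)^-1 *
    \sum_i \sum_t (x i t k w * x i t l w))); last first.
  apply: eq_Rintegral => w _; rewrite mxE summxE; congr (_ * _).
  apply: eq_bigr => i _; rewrite mxE; apply: eq_bigr => t _.
  by rewrite !mxE.
rewrite meanZ; last by apply: all_moments_sum => i _; exact: all_moments_sum.
rewrite mean_sum; last by move=> i _; exact: all_moments_sum.
by congr (_ * _); apply: eq_bigr => i _; rewrite mean_sum.
Qed.

Definition failure_bound (Lx Ld Lg u : R) : R :=
  p%:R * expR (1 - panel_rate C K * Lx) + N%:R * expR (1 - panel_rate C K * Ld)
  + T%:R * p%:R ^+ 2 * expR (1 - panel_rate C K * Lg)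
  + N%:R * T%:R * p%:R * (K * expR (- C * u ^+ 2)).

Lemma failure_bound_ge0 (Lx Ld Lg u : R) : 0 <= failure_bound Lx Ld Lg u.
Proof. by rewrite !addr_ge0// !mulr_ge0 ?exprn_ge0 ?expR_ge0// ltW. Qed.

(** The entries of the Gram matrix are controlled for each period [t]
    separately, because only the summation over the units is over independent
    terms; averaging over [t] then preserves the bound. *)
Lemma panel_event (Lx Ld Lg u rx rd rg : R) :
  0 <= Lx -> 0 <= Ld -> 0 <= Lg -> 0 < u -> 0 <= rx -> 0 <= rd -> 0 <= rg ->
  rx ^+ 2 = (N * T)%:R * Lx ^+ 3 -> rd ^+ 2 = T%:R * Ld ^+ 3 ->
  rg ^+ 2 = N%:R * Lg ^+ 3 ->
  exists Ev : set Om, [/\ measurable Ev,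
    ((1 - failure_bound Lx Ld Lg u)%:E <= P Ev)%E &
    forall w, Ev w ->
    [/\ forall k, `|\sum_i \sum_t x i t k w * eps i t w| <= rx,
        forall i, `|\sum_t eps i t w| <= rd,
        forall k l, `|((N * T)%:R)^-1 * (\sum_i \sum_t x i t k w * x i t l w)
                      - expected_gram x k l| <= rg / N%:R &
        forall i t k, `|x i t k w| <= u]].
Proof.
move=> Lx0 Ld0 Lg0 u0 rx0 rd0 rg0 rx2 rd2 rg2.
have am_x i t k : all_moments P (x i t k).
  by apply: (subgaussian_all_moments C0 K0); exact: (subgaussian_x A1 A2b).
have am_e i t : all_moments P (eps i t).
  by apply: (subgaussian_all_moments C0 K0); exact: (subgaussian_eps A1 A2b).
have ex k : measurable_fun setT (fun w => \sum_i \sum_t x i t k w * eps i t w).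
  apply: all_moments_measurable; apply: all_moments_sum => i _.
  by apply: all_moments_sum => t _; exact: all_momentsM.
have ed i : measurable_fun setT (fun w => \sum_t eps i t w).
  by apply: all_moments_measurable; apply: all_moments_sum.
have eg (v : 'I_T * 'I_p * 'I_p) : measurable_fun setT (fun w =>
    \sum_i (x i v.1.1 v.1.2 w * x i v.1.1 v.2 w - gram_mean x i v.1.1 v.1.2 v.2)).
  apply: all_moments_measurable; apply: all_moments_sum => i _.
  apply: all_momentsD; [exact: all_momentsM|exact: all_moments_cst].
have [mBx PBx] := @union_bound _ _ _ P 'I_p (fun k => [set w |
  rx < `|\sum_i \sum_t x i t k w * eps i t w|]) _ (expR_ge0 _)
  (fun k => measurable_gt_norm rx (ex k))
  (fun k => score_tail C0 K0 A1 A2b k N0 T0 Lx0 rx0 rx2).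
have [mBd PBd] := @union_bound _ _ _ P 'I_N (fun i => [set w |
  rd < `|\sum_t eps i t w|]) _ (expR_ge0 _)
  (fun i => measurable_gt_norm rd (ed i))
  (fun i => error_sum_tail C0 K0 A1 A2b i T0 Ld0 rd0 rd2).
have [mBg PBg] := @union_bound _ _ _ P ('I_T * 'I_p * 'I_p)%type (fun v => [set w |
  rg < `|\sum_i (x i v.1.1 v.1.2 w * x i v.1.1 v.2 w - gram_mean x i v.1.1 v.1.2 v.2)|])
  _ (expR_ge0 _) (fun v => measurable_gt_norm rg (eg v))
  (fun v => gram_tail C0 K0 A1 A2b v.1.1 v.1.2 v.2 N0 Lg0 rg0 rg2).
have [mBu PBu] := @union_bound _ _ _ P ('I_N * 'I_T * 'I_p)%type (fun v => [set w |
  u < `|x v.1.1 v.1.2 v.2 w|]) _ (mulr_ge0 (ltW K0) (expR_ge0 _))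
  (fun v => measurable_gt_norm u (all_moments_measurable (am_x _ _ _)))
  (fun v => x_tail K0 A1 A2b v.1.1 v.1.2 v.2 u0).
set Bx := [set w | _] in mBx PBx; set Bd := [set w | _] in mBd PBd.
set Bg := [set w | _] in mBg PBg; set Bu := [set w | _] in mBu PBu.
have mB : measurable (Bx `|` Bd `|` Bg `|` Bu) by do 3! apply: measurableU => //.
exists (~` (Bx `|` Bd `|` Bg `|` Bu)); split.
- exact: measurableC.
- rewrite probability_setC// EFinB leeB// /failure_bound !EFinD.
  apply: (le_trans (measureU2 _ _ _)) => //; first by do 2! apply: measurableU => //.
  apply: leeD; last first.
    by move: PBu; rewrite !card_prod !card_ord !natrM.
  apply: (le_trans (measureU2 _ _ _)) => //; first by apply: measurableU => //.
  apply: leeD; last first.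
    by move: PBg; rewrite !card_prod !card_ord !natrM expr2 mulrA.
  apply: (le_trans (measureU2 _ _ _)) => //.
  apply: leeD; first by move: PBx; rewrite card_ord.
  by move: PBd; rewrite card_ord.
move=> w nB; split.
- move=> k; rewrite leNgt; apply/negP => h; apply: nB.
  by left; left; left; exists k.
- move=> i; rewrite leNgt; apply/negP => h; apply: nB.
  by left; left; right; exists i.
- move=> k l; rewrite expected_gramE -mulrBr.
  have -> : \sum_i \sum_t x i t k w * x i t l w -
      \sum_i \sum_t gram_mean x i t k l =
      \sum_t \sum_i (x i t k w * x i t l w - gram_mean x i t k l).
    rewrite [RHS]exchange_big -sumrB; apply: eq_bigr => i _.
    by rewrite -sumrB.
  have NT0 : 0 < (N * T)%:R :> R by rewrite ltr0n muln_gt0 N0.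
  rewrite normrM ger0_norm ?invr_ge0 ?(ltW NT0)// [leLHS]mulrC ler_pdivrMr//.
  apply: (@le_trans _ _ (\sum_(t < T) rg)).
    apply: (le_trans (ler_norm_sum _ _ _)); apply: ler_sum => t _.
    rewrite leNgt; apply/negP => h; apply: nB.
    by left; right; exists (t, k, l).
  rewrite sumr_const card_ord natrM.
  by rewrite [leRHS]mulrA divfK ?mulr_natr// gt_eqF// ltr0n.
- move=> i t k; rewrite leNgt; apply/negP => h; apply: nB.
  by right; exists (i, t, k).
Qed.

End PanelEvent.

(** * The panel Lasso with the prescribed tuning parameters *)

Section Tuning.
Context {R : realType}.

Lemma powR_three_halves (y : R) : 0 <= y -> y `^ (3 / 2) = Num.sqrt (y ^+ 3).
Proof. by move=> y0; rewrite powRrM powR_mulrn// powR12_sqrt// exprn_ge0. Qed.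

Variables (N T p : nat).
Hypotheses (N1 : (1 < N)%N) (T0 : (0 < T)%N) (p1 : (1 < p)%N).

Let L : R := ln N%:R.
Let V : R := ln p%:R.

Let L0 : 0 < L. Proof. by rewrite ln_gt0// ltr1n. Qed.
Let V0 : 0 < V. Proof. by rewrite ln_gt0// ltr1n. Qed.
Let Np : 0 < N%:R :> R. Proof. by rewrite ltr0n ltnW. Qed.
Let Tp : 0 < T%:R :> R. Proof. by rewrite ltr0n. Qed.

Lemma lambda_NTE : lambda_NT N T p N%:R =
  2 * (Num.sqrt (V ^+ 3) * Num.sqrt (L ^+ 3)) * Num.sqrt (N * T)%:R.
Proof.
have e : 2 = Num.sqrt (2 ^+ 2) :> R by rewrite sqrtr_sqr ger0_norm.
rewrite /lambda_NT -/L -/V {1}e -!sqrtrM ?sqr_ge0 ?mulr_ge0 ?exprn_ge0 ?ltW//.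
by congr Num.sqrt; rewrite natrM; ring.
Qed.

Lemma mu_NTE : mu_NT N T N%:R =
  2 * (Num.sqrt (L ^+ 3) * Num.sqrt (L ^+ 3)) * Num.sqrt T%:R.
Proof.
have e : 2 = Num.sqrt (2 ^+ 2) :> R by rewrite sqrtr_sqr ger0_norm.
rewrite /mu_NT -/L {1}e -!sqrtrM ?sqr_ge0 ?mulr_ge0 ?exprn_ge0 ?ltW//.
by congr Num.sqrt; ring.
Qed.

(** A bound for the effect on the restricted eigenvalue of replacing the
    expected by the empirical Gram matrix; of the order
    [N^(c + 9b/2 - 1/2)] up to logarithms, whence the condition on [b] and
    [c]. *)
Definition gram_perturbation (s : nat) : R :=
  256 * s%:R * (V ^+ 3 * L ^+ 3 + L ^+ 6)
  * (Num.sqrt ((V * L ^+ 2) ^+ 3) + V * L) / Num.sqrt N%:R.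

Lemma gram_perturbation_ge (s : nat) (lam m : R) :
  1 / 2 <= V -> 1 <= L ->
  lam = 2 * (Num.sqrt (V ^+ 3) * Num.sqrt (L ^+ 3)) ->
  m = 2 * (Num.sqrt (L ^+ 3) * Num.sqrt (L ^+ 3)) ->
  16 * (lam * Num.sqrt s%:R + m * Num.sqrt s%:R) ^+ 2 *
    (Num.sqrt (N%:R * (V * L ^+ 2) ^+ 3) / N%:R / lam ^+ 2
     + 2 * (V * L / Num.sqrt N%:R) / (lam * m)) <= gram_perturbation s.
Proof.
move=> Vh Lh lamE mE.
have sN : 0 < Num.sqrt N%:R :> R by rewrite sqrtr_gt0.
have sV0 : 0 <= V ^+ 3 by rewrite exprn_ge0// ltW.
have sL0 : 0 <= L ^+ 3 by rewrite exprn_ge0// ltW.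
have lam2 : lam ^+ 2 = 4 * (V ^+ 3 * L ^+ 3).
  by rewrite lamE !exprMn !sqr_sqrtr//; ring.
have m_E : m = 2 * L ^+ 3 by rewrite mE -expr2 sqr_sqrtr.
have m2 : m ^+ 2 = 4 * L ^+ 6 by rewrite m_E; ring.
have V3 : (1 / 2) ^+ 3 <= V ^+ 3 by rewrite lerXn2r ?nnegrE// ltW.
have L3 : 1 <= L ^+ 3 by rewrite exprn_ege1.
have L6 : 1 <= L ^+ 6 by rewrite exprn_ege1.
have VL3 : (1 / 2) ^+ 3 <= V ^+ 3 * L ^+ 3 by rewrite -[leLHS]mulr1 ler_pM.
have lam0 : 0 <= lam by rewrite lamE !mulr_ge0// sqrtr_ge0.
have lamg : 1 / 2 <= lam.
  rewrite -(ler_pXn2r (n := 2))// ?nnegrE// lam2.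
  by move: VL3; rewrite !expr_div_n !expr1n; lra.
have lamp : 0 < lam by lra.
have mg : 2 <= m by rewrite m_E; lra.
have mp : 0 < m by lra.
set r := Num.sqrt ((V * L ^+ 2) ^+ 3).
have -> : Num.sqrt (N%:R * (V * L ^+ 2) ^+ 3) / N%:R = r / Num.sqrt N%:R.
  rewrite sqrtrM ?ltW// -/r.
  have {2}-> : N%:R = Num.sqrt N%:R ^+ 2 :> R by rewrite sqr_sqrtr// ltW.
  by field; rewrite gt_eqF.
have r0 : 0 <= r by exact: sqrtr_ge0.
rewrite -mulrDl exprMn sqr_sqrtr//.
have q0 : 0 <= r / Num.sqrt N%:R by rewrite divr_ge0// ltW.
have q1 : 0 <= V * L / Num.sqrt N%:R by rewrite divr_ge0 ?mulr_ge0 ?ltW.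
have h1 : r / Num.sqrt N%:R / lam ^+ 2 <= 2 * (r / Num.sqrt N%:R).
  rewrite ler_pdivrMr ?exprn_gt0// mulrAC ler_peMl// lam2.
  by move: VL3; rewrite !expr_div_n !expr1n; lra.
have h2 : 2 * (V * L / Num.sqrt N%:R) / (lam * m) <= 2 * (V * L / Num.sqrt N%:R).
  by rewrite ler_pdivrMr ?mulr_gt0// ler_peMr ?mulr_ge0//; nra.
have h3 : (lam + m) ^+ 2 <= 8 * (V ^+ 3 * L ^+ 3 + L ^+ 6).
  by have := sqr_ge0 (lam - m); rewrite sqrrB sqrrD lam2 m2; lra.
apply: (@le_trans _ _ (16 * (8 * (V ^+ 3 * L ^+ 3 + L ^+ 6) * s%:R) *
    (2 * (r / Num.sqrt N%:R) + 2 * (V * L / Num.sqrt N%:R)))).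
  apply: ler_pM.
  - by rewrite mulr_ge0// mulr_ge0// sqr_ge0.
  - by rewrite addr_ge0// divr_ge0 ?mulr_ge0 ?sqr_ge0// ltW.
  - by rewrite ler_pM2l// ler_wpM2r.
  - exact: lerD.
rewrite /gram_perturbation -/r le_eqVlt; apply/orP; left; apply/eqP.
by field; rewrite gt_eqF.
Qed.

End Tuning.

Section PanelLasso.
Context {d : measure_display} {Om : measurableType d} {R : realType}.
Context {P : probability Om R} {N T p : nat}.
Variables (x : 'I_N -> 'I_T -> 'I_p -> {RV P >-> R}).
Variables (eps : 'I_N -> 'I_T -> {RV P >-> R}).
Variables (C K : R) (b : 'cV[R]_p) (c : 'cV[R]_N) (s : nat).
Variables (bhat : Om -> 'cV[R]_p) (chat : Om -> 'cV[R]_N).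
Hypotheses (C0 : 0 < C) (K0 : 0 < K).
Hypotheses (N1 : (1 < N)%N) (T0 : (0 < T)%N) (p1 : (1 < p)%N).
Hypothesis A1 : assumption_A1 x eps.
Hypothesis A2b : assumption_A2b C K x eps.
Hypotheses (sb : #|support_set b| = s) (sc : #|support_set c| = s).
Hypothesis lasso : forall w,
  is_panel_lasso (lambda_NT N T p N%:R) (mu_NT N T N%:R) (fun i => X_mx x i w)
    (fun i => response x eps b c i w) (bhat w) (chat w).

Let L : R := ln N%:R.
Let V : R := ln p%:R.
Let k2 := kappa2 x (lambda_NT N T p N%:R) (mu_NT N T N%:R) s s.
Let xi := xi_NT N p s s N%:R k2.

Hypotheses (Vh : 1 / 2 <= V) (Lh : 1 <= L).
Hypotheses (k2_gt0 : 0 < k2) (small : gram_perturbation N p s <= k2 / 2).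

Lemma panel_lasso_event : exists Ev : set Om, [/\ measurable Ev,
  ((1 - failure_bound (N := N) (T := T) (p := p) C K
     (V * L) (L ^+ 2) (V * L ^+ 2) (V * L))%:E <= P Ev)%E &
  forall w, Ev w -> l2norm (bhat w - b) <= xi / Num.sqrt (N * T)%:R /\
                    l2norm (chat w - c) <= xi / Num.sqrt T%:R].
Proof.
have N0 : (0 < N)%N by exact: ltnW.
have V0 : 0 < V by move: Vh; lra.
have L0 : 0 < L by move: Lh; lra.
have sNT : 0 < Num.sqrt (N * T)%:R :> R by rewrite sqrtr_gt0 ltr0n muln_gt0 N0.
have sT : 0 < Num.sqrt T%:R :> R by rewrite sqrtr_gt0 ltr0n.
have lE : lambda_NT N T p N%:R =
    2 * (Num.sqrt (V ^+ 3) * Num.sqrt (L ^+ 3)) * Num.sqrt (N * T)%:R.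
  exact: lambda_NTE.
have mE : mu_NT N T N%:R =
    2 * (Num.sqrt (L ^+ 3) * Num.sqrt (L ^+ 3)) * Num.sqrt T%:R.
  exact: mu_NTE.
set lambda := lambda_NT N T p N%:R in lE *; set mu := mu_NT N T N%:R in mE *.
have s3 (y : R) : 0 < y -> 0 < Num.sqrt (y ^+ 3).
  by move=> y0; rewrite sqrtr_gt0 exprn_gt0.
have lambda0 : 0 < lambda by rewrite lE !mulr_gt0// s3.
have mu0 : 0 < mu by rewrite mE !mulr_gt0// s3.
have sq3 (y : R) : 0 < y -> Num.sqrt (y ^+ 3) ^+ 2 = y ^+ 3.
  by move=> y0; rewrite sqr_sqrtr// exprn_ge0// ltW.
have lx : (lambda / 2) ^+ 2 = (N * T)%:R * (V * L) ^+ 3.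
  have -> : lambda / 2 = Num.sqrt (V ^+ 3) * Num.sqrt (L ^+ 3) * Num.sqrt (N * T)%:R.
    by rewrite lE; field.
  by rewrite !exprMn !sq3// sqr_sqrtr//; ring.
have ld : (mu / 2) ^+ 2 = T%:R * (L ^+ 2) ^+ 3.
  have -> : mu / 2 = Num.sqrt (L ^+ 3) * Num.sqrt (L ^+ 3) * Num.sqrt T%:R.
    by rewrite mE; field.
  by rewrite !exprMn !sq3// sqr_sqrtr//; ring.
pose rg := Num.sqrt (N%:R * (V * L ^+ 2) ^+ 3).
have lg : rg ^+ 2 = N%:R * (V * L ^+ 2) ^+ 3.
  by rewrite sqr_sqrtr// mulr_ge0// exprn_ge0// mulr_ge0 ?sqr_ge0// ltW.
have VL0 : 0 < V * L by rewrite mulr_gt0.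
have VL2 : 0 <= V * L ^+ 2 by rewrite mulr_ge0 ?sqr_ge0// ltW.
have l20 : 0 <= lambda / 2 by rewrite divr_ge0// ltW.
have m20 : 0 <= mu / 2 by rewrite divr_ge0// ltW.
have [Ev [mEv PEv EvP]] := panel_event C0 K0 N0 T0 A1 A2b (ltW VL0) (sqr_ge0 L)
  VL2 VL0 l20 m20 (sqrtr_ge0 _) lx ld lg.
exists Ev; split=> // w /EvP [scX scD gX gD].
have lamE : lambda / Num.sqrt (N * T)%:R = 2 * (Num.sqrt (V ^+ 3) * Num.sqrt (L ^+ 3)).
  by rewrite lE mulfK// gt_eqF.
have mmE : mu / Num.sqrt T%:R = 2 * (Num.sqrt (L ^+ 3) * Num.sqrt (L ^+ 3)).
  by rewrite mE mulfK// gt_eqF.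
have xiE : 8 * (lambda / Num.sqrt (N * T)%:R * Num.sqrt #|support_set b|%:R +
    mu / Num.sqrt T%:R * Num.sqrt #|support_set c|%:R) / k2 = xi.
  rewrite /xi /xi_NT -/L -/V !powR_three_halves ?ltW// lamE mmE sb sc.
  by congr (_ / _); ring.
have eta0 : 0 <= rg / N%:R by rewrite divr_ge0// sqrtr_ge0.
have e1 i t k : X_mx x i w t k = x i t k w by rewrite mxE.
have e2 i t : (\col_t eps i t w) t 0 = eps i t w :> R by rewrite mxE.
have scX' k : `|\sum_i \sum_t X_mx x i w t k * (\col_t eps i t w) t 0| <= lambda / 2.
  apply: le_trans (scX k); rewrite le_eqVlt; apply/orP; left; apply/eqP.
  congr `|_|; apply: eq_bigr => i _; apply: eq_bigr => t _.
  by rewrite e1 e2.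
have scD' i : `|\sum_t (\col_t eps i t w) t 0| <= mu / 2.
  apply: le_trans (scD i); rewrite le_eqVlt; apply/orP; left; apply/eqP.
  by congr `|_|; apply: eq_bigr => t _; rewrite e2.
have gX' k l : `|((N * T)%:R)^-1 * (\sum_i \sum_t X_mx x i w t k * X_mx x i w t l)
    - expected_gram x k l| <= rg / N%:R.
  apply: le_trans (gX k l); rewrite le_eqVlt; apply/orP; left; apply/eqP.
  congr `|_ * _ - _|; apply: eq_bigr => i _; apply: eq_bigr => t _.
  by rewrite !e1.
have gD' i k : `|\sum_t X_mx x i w t k| <= T%:R * (V * L).
  apply: (le_trans (ler_norm_sum _ _ _)).
  apply: (@le_trans _ _ (\sum_(t < T) V * L)).
    by apply: ler_sum => t _; rewrite e1.
  by rewrite sumr_const card_ord mulr_natl.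
have RE (delta : 'cV[R]_(p + N)) :
    cone_condition (T := T) lambda mu (support_set b) (support_set c) delta ->
    k2 * l2norm delta ^+ 2 <=
      (delta^T *m block_mx (expected_gram x) 0 0 1%:M *m delta) 0 0.
  by apply: kappa2_le => //; rewrite ?sb ?sc.
have pert : 16 * (lambda / Num.sqrt (N * T)%:R * Num.sqrt #|support_set b|%:R +
      mu / Num.sqrt T%:R * Num.sqrt #|support_set c|%:R) ^+ 2 *
    (rg / N%:R / (lambda / Num.sqrt (N * T)%:R) ^+ 2 +
     2 * (V * L / Num.sqrt N%:R) / (lambda / Num.sqrt (N * T)%:R * (mu / Num.sqrt T%:R)))
    <= k2 / 2.
  apply: le_trans small; rewrite sb sc.
  exact: gram_perturbation_ge lamE mmE.
rewrite -xiE; split.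
  exact: (oracle_beta N0 T0 k2_gt0 lambda0 mu0 eta0 (ltW VL0) (lasso w)
    scX' scD' gX' gD' RE pert).
exact: (oracle_c N0 T0 k2_gt0 lambda0 mu0 eta0 (ltW VL0) (lasso w)
  scX' scD' gX' gD' RE pert).
Qed.

End PanelLasso.

(** * Asymptotics *)

Section Asymptotics.
Context {R : realType}.

Lemma near_ln_ge (M : R) : \forall N \near \oo, M <= ln N%:R :> R.
Proof.
near=> N; have h : expR M <= N%:R by near: N; exact: nbhs_infty_ger.
by rewrite -[M]expRK ler_ln// posrE ?expR_gt0// (lt_le_trans (expR_gt0 M)).
Unshelve. all: by end_near. Qed.

Lemma near_powR_gt (M r : R) : 0 < r -> \forall N \near \oo, M < N%:R `^ r :> R.
Proof.
move=> r0; near=> N.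
have h : expR (`|M| / r) <= N%:R by near: N; exact: nbhs_infty_ger.
apply: (@lt_le_trans _ _ (expR (`|M|))).
  apply: (le_lt_trans (ler_norm M)); apply: lt_le_trans (expR_ge1Dx _).
  by rewrite ltrDr.
have -> : expR `|M| = expR (`|M| / r) `^ r.
  by rewrite -expRM divfK// gt_eqF.
by apply: ge0_ler_powR; rewrite ?nnegrE ?expR_ge0// ltW.
Unshelve. all: by end_near. Qed.

Lemma near_logX_lt_powR (B e r : R) (k : nat) : 0 <= B -> 0 < e -> 0 < r ->
  \forall N \near \oo, B * ln N%:R ^+ k < e * N%:R `^ r :> R.
Proof.
move=> B0 e0 r0; pose dl : R := r / (2 * k.+1%:R).
have dl0 : 0 < dl by rewrite divr_gt0// mulr_gt0.
have r2 : 0 < r / 2 by rewrite divr_gt0.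
near=> N.
have N2 : 2 <= N%:R :> R by near: N; exact: nbhs_infty_ger.
have Np : 0 < N%:R :> R by lra.
have L0 : 0 <= ln N%:R :> R by rewrite ln_ge0//; lra.
have hL : ln N%:R <= N%:R `^ dl / dl.
  rewrite ler_pdivlMr// mulrC -ln_powR ltW// ln_sublinear//.
  by rewrite powR_gt0.
have hLk : ln N%:R ^+ k <= N%:R `^ (r / 2) / dl ^+ k.
  apply: (@le_trans _ _ ((N%:R `^ dl / dl) ^+ k)).
    by rewrite lerXn2r ?nnegrE ?divr_ge0 ?powR_ge0// ltW.
  rewrite expr_div_n ler_wpM2r ?invr_ge0 ?exprn_ge0 ?(ltW dl0)//.
  rewrite -powR_mulrn ?powR_ge0// -powRrM; apply: ler_powR; first by lra.
  rewrite /dl mulrAC ler_pdivrMr ?mulr_gt0// -[k.+1%:R]natr1.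
  by have k0 : 0 <= k%:R :> R by []; nra.
have big : B / dl ^+ k / e < N%:R `^ (r / 2) by near: N; exact: near_powR_gt.
have -> : N%:R `^ r = N%:R `^ (r / 2) * N%:R `^ (r / 2).
  rewrite -powRD; last by rewrite (gt_eqF Np) implybT.
  by congr (_ `^ _); field.
apply: (@le_lt_trans _ _ (B * (N%:R `^ (r / 2) / dl ^+ k))).
  by rewrite ler_wpM2l.
rewrite ltr_pdivrMr// in big.
rewrite mulrCA mulrC mulrA [e * _]mulrC ltr_pM2r ?powR_gt0//.
Unshelve. all: by end_near. Qed.

Lemma near_expRN_lt (B k e : R) : 0 < k -> 0 < e ->
  \forall N \near \oo, B * expR (- (k * ln N%:R)) < e :> R.
Proof.
move=> k0 e0; near=> N.
have h : `|B| / e / k <= ln N%:R by near: N; exact: near_ln_ge.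
rewrite expRN ltr_pdivrMr ?expR_gt0//.
rewrite ler_pdivrMr// [_ * k]mulrC ler_pdivrMr// in h.
apply: (le_lt_trans (ler_norm B)); apply: (le_lt_trans h).
rewrite [ltRHS]mulrC ltr_pM2r//; apply: lt_le_trans (expR_ge1Dx _).
by rewrite ltrDr.
Unshelve. all: by end_near. Qed.

Lemma rounding_bounds (n : nat) (y : R) : 1 <= y -> is_rounding n y ->
  [/\ (0 < n)%N, n%:R <= 2 * y & y <= 2 * n%:R].
Proof.
move=> y1; rewrite /is_rounding ltr_norml => /andP[h1 h2].
have n0 : (0 < n)%N by rewrite -(ltr0n R); lra.
have n1 : 1 <= n%:R :> R by rewrite ler1n.
by split => //; lra.
Qed.

Lemma half_le_ln2 : 1 / 2 <= ln 2 :> R.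
Proof.
rewrite -[leLHS]expRK ler_ln ?posrE ?expR_gt0//.
have := expR_half_mul_le1 (1 : R); lra.
Qed.

Lemma rounding_expR_bounds (n : nat) (y : R) : 1 <= y -> is_rounding n (expR y) ->
  [/\ (1 < n)%N, 1 / 2 <= ln n%:R :> R & ln n%:R <= 2 * y].
Proof.
move=> y1; rewrite /is_rounding ltr_norml => /andP[h1 h2].
have ey := expR_ge1Dx y.
have n1 : (1 < n)%N by rewrite -(ltr1n R); lra.
have n2 : 2 <= n%:R :> R by rewrite ler_nat.
split => //.
  by apply: (le_trans half_le_ln2); rewrite ler_ln// posrE; lra.
rewrite -[leRHS]expRK ler_ln ?posrE ?expR_gt0//; last by lra.
by rewrite mulr_natl mulr2n expRD; nra.
Qed.

Lemma sqrtX3_le (y z : R) : 0 <= y -> y <= 2 * z -> Num.sqrt (y ^+ 3) <= 3 * Num.sqrt (z ^+ 3).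
Proof.
move=> y0 yz; have z0 : 0 <= z by lra.
have e : 3 = Num.sqrt (3 ^+ 2) :> R by rewrite sqrtr_sqr ger0_norm.
rewrite [X in _ <= X * _]e -sqrtrM ?sqr_ge0// ler_sqrt ?mulr_ge0 ?exprn_ge0//.
apply: (@le_trans _ _ ((2 * z) ^+ 3)); first by rewrite lerXn2r ?nnegrE ?mulr_ge0.
have := exprn_ge0 3 z0; rewrite exprMn; lra.
Qed.

Lemma sqrt_le_double (y z : R) : 0 <= z -> y <= 2 * z -> Num.sqrt y <= 2 * Num.sqrt z.
Proof.
move=> z0 yz.
have e : 2 = Num.sqrt (2 ^+ 2) :> R by rewrite sqrtr_sqr ger0_norm.
rewrite [X in _ <= X * _]e -sqrtrM ?sqr_ge0// ler_sqrt ?mulr_ge0 ?sqr_ge0//; lra.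
Qed.

Lemma gram_perturbation_le (N p s : nat) (y q : R) :
  1 <= ln N%:R :> R -> 0 <= ln p%:R :> R -> ln p%:R <= 2 * y -> 1 <= y ->
  0 <= q -> s%:R <= 2 * q ->
  gram_perturbation N p s <=
    256 * 90 * ln N%:R ^+ 9 * (q * y ^+ 3 * Num.sqrt (y ^+ 3) / Num.sqrt N%:R).
Proof.
rewrite /gram_perturbation; set L := ln N%:R; set V := ln p%:R => L1 V0 Vy y1 q0 sq.
have L0 : 0 <= L by lra.
have y0 : 0 <= y by lra.
have L3 : 1 <= L ^+ 3 by rewrite exprn_ege1.
have L30 : 0 <= L ^+ 3 by lra.
have L6 : L ^+ 6 = L ^+ 3 * L ^+ 3 by ring.
have y3 : 1 <= y ^+ 3 by rewrite exprn_ege1.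
have V3 : V ^+ 3 <= 8 * y ^+ 3.
  apply: (@le_trans _ _ ((2 * y) ^+ 3)); first by rewrite lerXn2r ?nnegrE ?mulr_ge0.
  by rewrite exprMn; lra.
have V30 : 0 <= V ^+ 3 by rewrite exprn_ge0.
set r := Num.sqrt (y ^+ 3).
have r0 : 0 <= r by exact: sqrtr_ge0.
have yr : y <= r.
  rewrite /r -[leLHS]ger0_norm// -sqrtr_sqr ler_sqrt ?exprn_ge0//.
  by rewrite [leRHS]exprS ler_peMl ?exprn_ge0.
have h1 : V ^+ 3 * L ^+ 3 + L ^+ 6 <= 9 * y ^+ 3 * L ^+ 6.
  rewrite L6; apply: (@le_trans _ _ (8 * y ^+ 3 * (L ^+ 3 * L ^+ 3) +
    y ^+ 3 * (L ^+ 3 * L ^+ 3))); last by lra.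
  apply: lerD; last by rewrite ler_peMl// mulr_ge0.
  apply: ler_pM => //; exact: ler_peMr.
have h2 : Num.sqrt ((V * L ^+ 2) ^+ 3) <= 3 * r * L ^+ 3.
  have -> : (V * L ^+ 2) ^+ 3 = V ^+ 3 * (L ^+ 3) ^+ 2 by ring.
  rewrite sqrtrM// sqrtr_sqr (ger0_norm L30) ler_wpM2r//.
  exact: sqrtX3_le.
have h3 : V * L <= 2 * r * L ^+ 3.
  apply: ler_pM => //; first by apply: (le_trans Vy); rewrite ler_pM2l.
  by rewrite -[leLHS]expr1 ler_weXn2l.
rewrite [leRHS](_ : _ = 256 * (2 * q) * (9 * y ^+ 3 * L ^+ 6) *
    (3 * r * L ^+ 3 + 2 * r * L ^+ 3) / Num.sqrt N%:R); last by ring.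
rewrite ler_wpM2r ?invr_ge0 ?sqrtr_ge0//.
apply: ler_pM.
- by rewrite !mulr_ge0// addr_ge0 ?mulr_ge0// exprn_ge0.
- by rewrite addr_ge0 ?sqrtr_ge0 ?mulr_ge0.
- apply: ler_pM => //; last by rewrite ler_pM2l.
  by rewrite addr_ge0 ?mulr_ge0// exprn_ge0.
- exact: lerD.
Qed.

Lemma xi_NT_le (N p s : nat) (y q k0 k2 : R) :
  1 <= ln N%:R :> R -> 0 <= ln p%:R :> R -> ln p%:R <= 2 * y -> 1 <= y ->
  0 <= q -> s%:R <= 2 * q -> 0 < k0 -> k0 <= k2 ->
  xi_NT N p s s N%:R k2 <=
    128 / k0 * ln N%:R ^+ 4 * (Num.sqrt q * Num.sqrt (y ^+ 3)).
Proof.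
rewrite /xi_NT; set L := ln N%:R; set V := ln p%:R => L1 V0 Vy y1 q0 sq k00 k02.
have L0 : 0 <= L by lra.
have y0 : 0 <= y by lra.
rewrite !powR_three_halves//.
set r := Num.sqrt (y ^+ 3).
have r1 : 1 <= r.
  by rewrite /r -[leLHS]sqrtr1 ler_sqrt ?exprn_ge0// exprn_ege1.
have L2 : 1 <= L ^+ 2 by rewrite exprn_ege1.
have hL : Num.sqrt (L ^+ 3) <= L ^+ 2.
  rewrite -[leRHS]ger0_norm ?sqr_ge0// -sqrtr_sqr ler_sqrt ?exprn_ge0 ?sqr_ge0//.
  by rewrite -exprM ler_weXn2l.
have hV : Num.sqrt (V ^+ 3) <= 3 * r by exact: sqrtX3_le.
have hs : Num.sqrt s%:R <= 2 * Num.sqrt q by exact: sqrt_le_double.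
have k20 : 0 < k2 by lra.
rewrite [leRHS](_ : _ = 16 * L ^+ 2 * (4 * r * L ^+ 2 * (2 * Num.sqrt q)) / k0);
  last by ring.
apply: ler_pM.
- by rewrite !mulr_ge0 ?addr_ge0 ?mulr_ge0 ?sqrtr_ge0.
- by rewrite invr_ge0 ltW.
- apply: ler_pM.
  + by rewrite mulr_ge0 ?sqrtr_ge0.
  + by rewrite addr_ge0 ?mulr_ge0 ?sqrtr_ge0.
  + by rewrite ler_pM2l.
  rewrite -mulrDl; apply: ler_pM; rewrite ?addr_ge0 ?sqrtr_ge0//.
  have : r <= r * L ^+ 2 by rewrite ler_peMr//; lra.
  have : L ^+ 2 <= r * L ^+ 2 by rewrite ler_peMl//; lra.
  lra.
- by rewrite lef_pV2.
Qed.

(** All four terms decay like a power of [N], since the exponents exceed the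
    logarithms of the numbers of events by at least one factor [log N]. *)
Lemma failure_bound_le (N T p : nat) (C K a th : R) :
  (0 < N)%N -> (0 < p)%N -> th = panel_rate C K -> 0 < K -> 0 <= a ->
  T%:R <= 2 * N%:R `^ a -> 1 / 2 <= ln p%:R :> R -> 1 <= ln N%:R :> R ->
  2 * a + 4 <= th * ln N%:R -> 2 * a + 5 <= C / 2 * ln N%:R -> 0 < th -> 0 < C ->
  failure_bound (N := N) (T := T) (p := p) C K (ln p%:R * ln N%:R)
    (ln N%:R ^+ 2) (ln p%:R * ln N%:R ^+ 2) (ln p%:R * ln N%:R)
  <= expR 1 * expR (- (th / 4 * ln N%:R)) +
     (expR 1 + expR 2 + K * expR 1) * expR (- (1 * ln N%:R)).
Proof.
move=> N0 p0 thE K0 a0; rewrite /failure_bound -thE.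
have Np : 0 < N%:R :> R by rewrite ltr0n.
have pp : 0 < p%:R :> R by rewrite ltr0n.
have NE : N%:R = expR (ln N%:R) :> R by rewrite lnK.
have pE : p%:R = expR (ln p%:R) :> R by rewrite lnK.
have aE : N%:R `^ a = expR (a * ln N%:R) by rewrite mulrC expRM -NE.
rewrite aE; move: NE pE; set L := ln N%:R; set V := ln p%:R => NE pE Ta Vh L1 hth hC th0 C0.
have e2 : 2 <= expR 1 :> R by have := expR_ge1Dx (1 : R); lra.
have Te : T%:R <= expR (1 + a * L).
  by apply: (le_trans Ta); rewrite expRD ler_wpM2r ?expR_ge0.
have thL : 2 <= th * L by lra.
have aL : 0 <= a * L by rewrite mulr_ge0//; lra.
have t1 : p%:R * expR (1 - th * (V * L)) <= expR 1 * expR (- (th / 4 * L)).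
  rewrite pE -!expRD ler_expR; have : 1 / 2 * (th * L - 1) <= V * (th * L - 1).
    by rewrite ler_wpM2r//; lra.
  lra.
have t2 : N%:R * expR (1 - th * L ^+ 2) <= expR 1 * expR (- (1 * L)).
  rewrite NE -!expRD ler_expR expr2; have : 2 * L <= th * L * L.
    by rewrite ler_wpM2r//; lra.
  lra.
have t3 : T%:R * p%:R ^+ 2 * expR (1 - th * (V * L ^+ 2)) <= expR 2 * expR (- (1 * L)).
  rewrite pE -expRM_natl; apply: (@le_trans _ _
      (expR (1 + a * L) * expR (2 * V) * expR (1 - th * (V * L ^+ 2)))).
    by rewrite ler_wpM2r ?expR_ge0// ler_wpM2r ?expR_ge0.
  rewrite -!expRD ler_expR.
  have h1 : (2 * a + 4) * L <= th * L * L by rewrite ler_wpM2r//; lra.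
  have h2 : 1 / 2 * ((2 * a + 2) * L) <= V * (th * L * L - 2).
    by apply: ler_pM => //; [rewrite mulr_ge0//; lra|lra].
  have e3 : th * (V * L ^+ 2) = V * (th * L * L) by ring.
  by rewrite e3; lra.
have t4 : N%:R * T%:R * p%:R * (K * expR (- C * (V * L) ^+ 2)) <=
    K * expR 1 * expR (- (1 * L)).
  rewrite NE pE; apply: (@le_trans _ _
      (expR L * expR (1 + a * L) * expR V * (K * expR (- C * (V * L) ^+ 2)))).
    rewrite ler_wpM2r ?mulr_ge0 ?expR_ge0 ?(ltW K0)// ler_wpM2r ?expR_ge0//.
    by rewrite ler_wpM2l ?expR_ge0.
  rewrite [leLHS]mulrCA -[leRHS]mulrA ler_pM2l// -!expRD ler_expR.
  have h1 : (2 * a + 5) * L <= C / 2 * L * L by rewrite ler_wpM2r//; lra.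
  have h2 : 1 / 2 * (V * (L * L)) <= V * (V * (L * L)).
    by rewrite ler_wpM2r// !mulr_ge0//; lra.
  have h3 : C * (1 / 2 * (V * (L * L))) <= C * (V * (V * (L * L))).
    by rewrite ler_pM2l.
  have h4 : V * ((2 * a + 5) * L) <= V * (C / 2 * L * L).
    by rewrite ler_wpM2l//; lra.
  have h5 : 1 / 2 * ((2 * a + 4) * L) <= V * ((2 * a + 5) * L - 1).
    by apply: ler_pM => //; [rewrite mulr_ge0//; lra|lra].
  have e5 : C * (V * (V * (L * L))) = C * (V * L) ^+ 2 by ring.
  have e6 : C * (1 / 2 * (V * (L * L))) = V * (C / 2 * L * L) by field.
  lra.
by rewrite mulrDl mulrDl -!addrA; apply: lerD => //; apply: lerD => //; apply: lerD.
Qed.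

End Asymptotics.

(** * Consistency and detection of the support *)

Lemma nonzero_of_min_abs_support {R : realType} {n : nat} (v vhat : 'cV[R]_n) (r : R) :
  l2norm (vhat - v) <= r -> r < min_abs_support v ->
  forall j, j \in support_set v -> vhat j 0 != 0.
Proof.
move=> vr rv j jv; apply/eqP => vj0.
have : min_abs_support v <= `|v j 0|.
  apply: ge_inf; last by exists j.
  by exists 0 => _ [k _ ->].
have := entry_le_l2norm (vhat - v) j; rewrite !mxE vj0 sub0r normrN.
by move: vr rv; lra.
Qed.

Theorem theorem5 (R : realType) (a b c : R)
  (a_ge0 : 0 <= a) (b_ge0 : 0 <= b) (c_ge0 : 0 <= c)
  (* dimensions and sparsity *)
  (T p s : nat -> nat)
  (T_def : \forall N \near \oo, is_rounding (T N) (N%:R `^ a))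
  (p_def : \forall N \near \oo, is_rounding (p N) (expR (N%:R `^ b)))
  (s_def : \forall N \near \oo, is_rounding (s N) (N%:R `^ c))
  (* the panel data model with N cross-sectional units *)
  (d : nat -> measure_display) (Om : forall N, measurableType (d N))
  (P : forall N, probability (Om N) R)
  (x : forall N, 'I_N -> 'I_(T N) -> 'I_(p N) -> {RV (P N) >-> R})
  (eps : forall N, 'I_N -> 'I_(T N) -> {RV (P N) >-> R})
  (bstar : forall N, 'cV[R]_(p N)) (cstar : forall N, 'cV[R]_N)
  (s1_def : \forall N \near \oo, #|support_set (bstar N)| = s N)
  (s2_def : \forall N \near \oo, #|support_set (cstar N)| = s N)
  (A1 : forall N, assumption_A1 (x N) (eps N))
  (C K : R) (C_gt0 : 0 < C) (K_gt0 : 0 < K)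
  (A2b : forall N, assumption_A2b C K (x N) (eps N))
  (* the panel Lasso, with a_{N,T} = N *)
  (bhat : forall N, Om N -> 'cV[R]_(p N)) (chat : forall N, Om N -> 'cV[R]_N)
  (lasso : forall N w,
    is_panel_lasso (lambda_NT N (T N) (p N) N%:R) (mu_NT N (T N) N%:R)
      (fun i => X_mx (x N) i w)
      (fun i => response (x N) (eps N) (bstar N) (cstar N) i w)
      (bhat N w) (chat N w))
  (* kappa^2 is bounded away from zero *)
  (k2 : nat -> R)
  (k2_def : forall N, k2 N =
    kappa2 (x N) (lambda_NT N (T N) (p N) N%:R) (mu_NT N (T N) N%:R)
      #|support_set (bstar N)| #|support_set (cstar N)|)
  (k2_bdd : exists2 k0 : R, 0 < k0 & \forall N \near \oo, k0 <= k2 N)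
  (xi : nat -> R)
  (xi_def : forall N, xi N =
    xi_NT N (p N) #|support_set (bstar N)| #|support_set (cstar N)|
      N%:R (k2 N))
  (bc_small : 9 * b + 2 * c < 1) :
  exists E : forall N, set (Om N),
    (forall N, measurable (E N)) /\
    P N (E N) @[N --> \oo] --> 1%E /\
    (* (1) *)
    (forall e : R, 0 < e -> \forall N \near \oo, forall w, E N w ->
      l2norm (bhat N w - bstar N) < e) /\
    (3 * b + c < a ->
      forall e : R, 0 < e -> \forall N \near \oo, forall w, E N w ->
      l2norm (chat N w - cstar N) < e) /\
    (* (2) *)
    ((\forall N \near \oo,
        xi N / Num.sqrt (N * T N)%:R < min_abs_support (bstar N)) ->
      \forall N \near \oo, forall w, E N w ->
      forall j, j \in support_set (bstar N) -> bhat N w j 0 != 0) /\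
    ((\forall N \near \oo,
        xi N / Num.sqrt (T N)%:R < min_abs_support (cstar N)) ->
      \forall N \near \oo, forall w, E N w ->
      forall i, i \in support_set (cstar N) -> chat N w i 0 != 0).
Proof.
case: k2_bdd => k0 k00 k2k0.
(* The event is prescribed only for the sizes [N] in the asymptotic range; for
   the finitely many others the whole space is taken. *)
pose L (N : nat) : R := ln N%:R; pose V (N : nat) : R := ln (p N)%:R.
pose dl N := failure_bound (N := N) (T := T N) (p := p N) C K
  (V N * L N) (L N ^+ 2) (V N * L N ^+ 2) (V N * L N).
pose regular N := [/\ (1 < N)%N, (0 < T N)%N, (1 < p N)%N & 1 / 2 <= V N] /\
  [/\ 1 <= L N, #|support_set (bstar N)| = s N, #|support_set (cstar N)| = s N,
      0 < k2 N & gram_perturbation N (p N) (s N) <= k2 N / 2].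
have event N : exists Ev : set (Om N), measurable Ev /\ (regular N ->
    ((1 - dl N)%:E <= P N Ev)%E /\ forall w, Ev w ->
    l2norm (bhat N w - bstar N) <= xi N / Num.sqrt (N * T N)%:R /\
    l2norm (chat N w - cstar N) <= xi N / Num.sqrt (T N)%:R).
  have [|nreg] := pselect (regular N); last by exists setT; split.
  move=> [[N1 T0 p1 Vh] [Lh sb sc k20 small]].
  have k2E : k2 N = kappa2 (x N) (lambda_NT N (T N) (p N) N%:R) (mu_NT N (T N) N%:R)
    (s N) (s N) by rewrite k2_def sb sc.
  have xiE : xi N = xi_NT N (p N) (s N) (s N) N%:R (k2 N) by rewrite xi_def sb sc.
  rewrite k2E in k20 small; rewrite k2E in xiE.
  have [Ev [mEv PEv EvP]] := panel_lasso_event C_gt0 K_gt0 N1 T0 p1 (A1 N) (A2b N)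
    sb sc (lasso N) Vh Lh k20 small.
  by exists Ev; split => // _; split => // w /EvP; rewrite xiE.
pose E N := projT1 (cid (event N)).
have mE N : measurable (E N) by rewrite /E; case: cid => Ev [].
have EP N : regular N -> ((1 - dl N)%:E <= P N (E N))%E /\ forall w, E N w ->
    l2norm (bhat N w - bstar N) <= xi N / Num.sqrt (N * T N)%:R /\
    l2norm (chat N w - cstar N) <= xi N / Num.sqrt (T N)%:R.
  by rewrite /E; case: cid => Ev [].
have big (N : nat) (r : R) : 1 <= N%:R :> R -> 0 <= r -> 1 <= N%:R `^ r :> R.
  by move=> N1 r0; rewrite -[leLHS](powRr0 (N%:R : R)) ler_powR.
pose sized (N : nat) := [/\ [/\ (1 < N)%N, 1 <= N%:R :> R & 1 <= L N],
    [/\ (0 < T N)%N, (T N)%:R <= 2 * N%:R `^ a & N%:R `^ a <= 2 * (T N)%:R],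
    [/\ (1 < p N)%N, 1 / 2 <= V N & V N <= 2 * N%:R `^ b] &
    (s N)%:R <= 2 * N%:R `^ c].
have sizes : \forall N \near \oo, sized N.
  near=> N.
  have N1 : (1 < N)%N by near: N; exact: nbhs_infty_gt.
  have N1' : 1 <= N%:R :> R by rewrite ler1n ltnW.
  have TN : is_rounding (T N) (N%:R `^ a) by near: N.
  have pN : is_rounding (p N) (expR (N%:R `^ b)) by near: N.
  have sN : is_rounding (s N) (N%:R `^ c) by near: N.
  split.
  - by split => //; near: N; exact: near_ln_ge.
  - exact: rounding_bounds (big _ _ N1' a_ge0) TN.
  - exact: rounding_expR_bounds (big _ _ N1' b_ge0) pN.
  - by have [] := rounding_bounds (big _ _ N1' c_ge0) sN.
have k2pos : \forall N \near \oo, 0 < k2 N.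
  near=> N; apply: lt_le_trans k00 _; near: N; exact: k2k0.
have powE (N : nat) (r : R) : Num.sqrt (N%:R `^ r) = N%:R `^ (r / 2) :> R.
  by rewrite -powR12_sqrt ?powR_ge0// -powRrM.
have powX3 (N : nat) (r : R) : (N%:R `^ r) ^+ 3 = N%:R `^ (3 * r) :> R.
  by rewrite -powR_mulrn ?powR_ge0// -powRrM mulrC.
have powM (N : nat) (r r' : R) : (1 < N)%N ->
    N%:R `^ r * N%:R `^ r' = N%:R `^ (r + r') :> R.
  move=> N1; rewrite powRD//; apply/implyP => _.
  by rewrite gt_eqF// ltr0n ltnW.
have sqrtE (N : nat) : Num.sqrt N%:R = N%:R `^ (1 / 2) :> R.
  by rewrite mul1r powR12_sqrt.
have small : \forall N \near \oo, gram_perturbation N (p N) (s N) <= k2 N / 2.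
  have B0 : 0 <= 256 * 90 :> R by rewrite mulr_ge0.
  have k2' : 0 < k0 / 2 by rewrite divr_gt0.
  have r0 : 0 < 1 / 2 - (c + 3 * b + 3 * b / 2) by lra.
  near=> N.
  have [[N1 N1' LN] _ [p1 Vh Vb] sc] : sized N by near: N.
  have V0 : 0 <= V N by lra.
  apply: (le_trans (gram_perturbation_le LN V0 Vb (big _ _ N1' b_ge0)
    (powR_ge0 _ _) sc)).
  apply: (@le_trans _ _ (k0 / 2)); last first.
    by rewrite ler_pM2r ?invr_gt0//; near: N.
  have Np : 0 < N%:R :> R by lra.
  rewrite mulrA ler_pdivrMr; last by rewrite sqrtr_gt0.
  rewrite powX3 powE sqrtE !powM//.
  have rate : 256 * 90 * L N ^+ 9 < k0 / 2 *
      N%:R `^ (1 / 2 - (c + 3 * b + 3 * b / 2)).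
    near: N; exact: (near_logX_lt_powR 9 B0 k2' r0).
  have q0 : 0 < N%:R `^ (c + 3 * b + 3 * b / 2) :> R by rewrite powR_gt0.
  move: rate; rewrite -(ltr_pM2r q0) -[ltRHS]mulrA powM// subrK.
  exact: ltW.
have regN : \forall N \near \oo, regular N.
  near=> N.
  have [[N1 N1' LN] [T0 _ _] [p1 Vh Vb] sc] : sized N by near: N.
  by split; split => //; near: N.
have th0 : 0 < panel_rate C K by exact: tail_rate_gt0.
have C20 : 0 < C / 2 by rewrite divr_gt0.
have dl_small (e : R) : 0 < e -> \forall N \near \oo, dl N < e.
  move=> e0.
  have th4 : 0 < panel_rate C K / 4 by rewrite divr_gt0.
  have e2 : 0 < e / 2 by rewrite divr_gt0.
  near=> N.
  have [[N1 N1' LN] [T0 Ta _] [p1 Vh Vb] sc] : sized N by near: N.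
  have L1 : 2 * a + 4 <= panel_rate C K * L N.
    rewrite [leRHS]mulrC -(ler_pdivrMr _ _ th0); near: N; exact: near_ln_ge.
  have L2 : 2 * a + 5 <= C / 2 * L N.
    rewrite [leRHS]mulrC -(ler_pdivrMr _ _ C20); near: N; exact: near_ln_ge.
  apply: (le_lt_trans (failure_bound_le (ltnW N1) (ltnW p1) erefl K_gt0 a_ge0
    Ta Vh LN L1 L2 th0 C_gt0)).
  have h1 : expR 1 * expR (- (panel_rate C K / 4 * ln N%:R)) < e / 2.
    by near: N; exact: (near_expRN_lt _ th4 e2).
  have h2 : (expR 1 + expR 2 + K * expR 1) * expR (- (1 * ln N%:R)) < e / 2.
    by near: N; exact: (near_expRN_lt _ ltr01 e2).
  lra.
(* [D] stands for the two scalings [sqrt (N T)] and [sqrt T]. *)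
have xi_small (D : nat -> R) (g e : R) : 3 * b + c < g -> 0 < e ->
    (\forall N \near \oo, N%:R `^ (g / 2) <= 2 * D N) ->
    \forall N \near \oo, xi N / D N < e.
  move=> bcg e0 DN.
  have B0 : 0 <= 256 / k0 by rewrite divr_ge0// ltW.
  have r0 : 0 < g / 2 - (c / 2 + 3 * b / 2) by lra.
  near=> N.
  have [[N1 N1' LN] _ [p1 Vh Vb] sc] : sized N by near: N.
  have V0 : 0 <= V N by lra.
  have Np : 0 < N%:R :> R by lra.
  have hD : N%:R `^ (g / 2) <= 2 * D N by near: N.
  have gp : 0 < N%:R `^ (g / 2) :> R by rewrite powR_gt0.
  have Dp : 0 < D N by lra.
  have [_ [_ sb sc' _ _]] : regular N by near: N.
  have kN : k0 <= k2 N by near: N.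
  rewrite ltr_pdivrMr// xi_def sb sc'.
  apply: (le_lt_trans (xi_NT_le LN V0 Vb (big _ _ N1' b_ge0)
    (powR_ge0 _ _) sc k00 kN)).
  rewrite powX3 !powE powM//.
  have rate : 256 / k0 * L N ^+ 4 < e * N%:R `^ (g / 2 - (c / 2 + 3 * b / 2)).
    near: N; exact: (near_logX_lt_powR 4 B0 e0 r0).
  have q0 : 0 < N%:R `^ (c / 2 + 3 * b / 2) :> R by rewrite powR_gt0.
  move: rate; rewrite -(ltr_pM2r q0) -[ltRHS]mulrA powM// subrK.
  have := ler_wpM2l (ltW e0) hD; rewrite -/(L N).
  have -> : 256 / k0 * L N ^+ 4 * N%:R `^ (c / 2 + 3 * b / 2) =
    2 * (128 / k0 * L N ^+ 4 * N%:R `^ (c / 2 + 3 * b / 2)) by ring.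
  lra.
have xib (e : R) : 0 < e -> \forall N \near \oo, xi N / Num.sqrt (N * T N)%:R < e.
  move=> e0; apply: (xi_small _ 1) => //; first by lra.
  near=> N.
  have [[N1 N1' _] [T0 _ _] _ _] : sized N by near: N.
  rewrite -sqrtE; apply: (@le_trans _ _ (Num.sqrt (N * T N)%:R)).
    by rewrite ler_sqrt ?ler0n// ler_nat leq_pmulr.
  by rewrite ler_peMl ?sqrtr_ge0// ler1n.
have dl_cvg : 1 - dl N @[N --> \oo] --> (1 : R).
  apply/cvgrPdist_lt => e e0; near=> N.
  rewrite opprB addrC subrK ger0_norm; first by near: N; exact: dl_small.
  exact: failure_bound_ge0.
exists E; split => //; split; [|split; [|split; [|split]]].
- apply: (@squeeze_cvge _ _ _ _ (fun N => (1 - dl N)%:E) (fun N => P N (E N)) (cst 1%E)).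
  + near=> N; apply/andP; split; last exact: probability_le1.
    have rN : regular N by near: N.
    by have [] := EP N rN.
  + by apply: cvg_EFin; [exact: nearW|exact: dl_cvg].
  + exact: cvg_cst.
- move=> e e0; near=> N => w Ew.
  have rN : regular N by near: N.
  have [_ /(_ w Ew)[h _]] := EP N rN.
  apply: (le_lt_trans h); near: N; exact: xib.
- move=> ac e e0; near=> N => w Ew.
  have rN : regular N by near: N.
  have [_ /(_ w Ew)[_ h]] := EP N rN.
  apply: (le_lt_trans h); near: N; apply: (xi_small _ a) => //.
  near=> N'; have [_ [_ _ Ta] _ _] : sized N' by near: N'.
  rewrite -powE; apply: sqrt_le_double => //.
- move=> bmin; near=> N => w Ew.
  have rN : regular N by near: N.
  have [_ /(_ w Ew)[h _]] := EP N rN.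
  apply: (nonzero_of_min_abs_support h); near: N; exact: bmin.
- move=> cmin; near=> N => w Ew.
  have rN : regular N by near: N.
  have [_ /(_ w Ew)[_ h]] := EP N rN.
  apply: (nonzero_of_min_abs_support h); near: N; exact: cmin.
Unshelve. all: by end_near. Qed.
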